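(* For every $k\in\mathbb{N}$, the operator $S\oplus(S_k^+)^*$ is cyclic, where $S$ is the simple bilateral shift on $\ell^2(\mathbb{Z})$ and $S_k^+$ is the orthogonal sum of $k$ copies of the simple unilateral shift $S^+$ on $\ell^2(\mathbb{N}_0)$.
   Context: $Se_n=e_{n+1}$ ($n\in\mathbb{Z}$) and $S^+e_n=e_{n+1}$ ($n\in\mathbb{N}_0$) for the standard orthonormal bases. An operator $T$ on $\mathcal{H}$ is cyclic if there is $h$ with $\bigvee\{T^nh:n\in\mathbb{N}_0\}=\mathcal{H}$. *)

(* Defs.v *)
From Stdlib Require Import Reals ZArith List.
Import ListNotations.
Open Scope R_scope.

Definition C := (R * R)%type.
Definition C0 : C := (0, 0).
Definition Cadd (a b : C) : C := (fst a + fst b, snd a + snd b).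
Definition Copp (a : C) : C := (- fst a, - snd a).
Definition Cmul (a b : C) : C :=
  (fst a * fst b - snd a * snd b, fst a * snd b + snd a * fst b).
Definition Cnorm2 (a : C) : R := fst a * fst a + snd a * snd a.

(* The Hilbert space H_k = l^2(Z) (+) (l^2(N_0))^k.
   A vector is a pair (u, v): u : Z -> C the l^2(Z) component,
   v j n (j < k, n : nat) the n-th coordinate of the j-th copy of l^2(N_0). *)
Definition vec := ((Z -> C) * (nat -> nat -> C))%type.

Definition vadd (x y : vec) : vec :=
  (fun z => Cadd (fst x z) (fst y z), fun j n => Cadd (snd x j n) (snd y j n)).
Definition vsub (x y : vec) : vec :=
  (fun z => Cadd (fst x z) (Copp (fst y z)),
   fun j n => Cadd (snd x j n) (Copp (snd y j n))).
Definition vscale (c : C) (x : vec) : vec :=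
  (fun z => Cmul c (fst x z), fun j n => Cmul c (snd x j n)).
Definition vzero : vec := (fun _ => C0, fun _ _ => C0).

Fixpoint sumZ (f : Z -> R) (l : list Z) : R :=
  match l with [] => 0 | z :: l' => f z + sumZ f l' end.
Fixpoint sumNN (f : nat -> nat -> R) (l : list (nat * nat)) : R :=
  match l with [] => 0 | p :: l' => f (fst p) (snd p) + sumNN f l' end.

Definition energy (k : nat) (x : vec) (l : list Z) (m : list (nat * nat)) : R :=
  sumZ (fun z => Cnorm2 (fst x z)) l
  + sumNN (fun j n => if Nat.ltb j k then Cnorm2 (snd x j n) else 0) m.

Definition inH (k : nat) (x : vec) : Prop :=
  (forall j n, (k <= j)%nat -> snd x j n = C0) /\
  exists B : R, forall l m, NoDup l -> NoDup m -> energy k x l m <= B.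

Definition dist_lt (k : nat) (x y : vec) (eps : R) : Prop :=
  exists d : R, 0 <= d /\ d < eps /\
    forall l m, NoDup l -> NoDup m -> energy k (vsub x y) l m <= d * d.

(* T = S (+) (S_k^+)^* : S e_n = e_{n+1} on l^2(Z), so (S u)(z) = u(z-1);
   (S^+)^* e_n = e_{n-1}, (S^+)^* e_0 = 0, so ((S^+)^* w)(n) = w(n+1). *)
Definition Top (x : vec) : vec :=
  (fun z => fst x (z - 1)%Z, fun j n => snd x j (S n)).

Definition Tpow (n : nat) (x : vec) : vec := Nat.iter n Top x.

Fixpoint lincomb (c : nat -> C) (h : vec) (N : nat) : vec :=
  match N with
  | O => vscale (c O) h
  | S N' => vadd (lincomb c h N') (vscale (c N) (Tpow N h))
  end.

Definition cyclic_T (k : nat) : Prop :=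
  exists h : vec, inH k h /\
    forall x : vec, inH k x -> forall eps : R, 0 < eps ->
      exists (N : nat) (c : nat -> C), dist_lt k x (lincomb c h N) eps.

(* Main.v *)
(** If [p = 1 + X q], then [y = p(T) y - q(T) T y].  Hence a closed [T]-invariant
    subspace [M] containing [T y] contains [y] as soon as vectors [p(T) y] with
    [p(0) = 1] come arbitrarily close to [M].

    Realise the bilateral shift as multiplication by [z] on the circle and put
    [s = (1 - cos t) / 2], [f = exp (-1/s)].  The polynomial [P_n] whose real part is
    [n] times the Fejer kernel satisfies [Re P_n <= 1/s] and [P_n(0) = n], so
    [G = (1 + (P_n - n)/N)^N], which imitates [exp (P_n - n)], has [G(0) = 1] while
    [|G f|] is about [exp (-n)].  Thus the Fourier vector [u] of [f] is nearly
    annihilated by polynomials with constant term 1, and by the remark above a closed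
    invariant subspace containing [u] is invariant under the inverse shift; as [1/f]
    is approximated by polynomials in [s], it contains all of [l^2(Z)].

    Let [v] carry rapidly decreasing amplitudes [a_m] at positions [m^2], distributed
    cyclically over the [k] copies of [l^2(N)], and let [M] be a closed invariant
    subspace containing [(u, v)].  Choose [G_m] with [|G_m u|] much smaller than
    [a_m]: then [G_m(T) T^(m^2 - n) (u, v) / a_m] is close to [G_m(T) e_(j,n)] for
    [m = j] modulo [k], so by induction on [n] the remark puts every [e_(j,n)] in [M].
    Hence [v], then [u], and finally the whole space lie in [M]. *)

From Stdlib Require Import Reals ZArith List FinFun Lra Lia.
From Stdlib Require Import FunctionalExtensionality ClassicalEpsilon.
From Coquelicot Require Import Coquelicot.
Require Import Defs.
Import ListNotations.
Open Scope R_scope.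

(** * Square-summable families *)

Definition lsum {A : Type} (f : A -> R) (s : list A) : R :=
  fold_right (fun a r => f a + r) 0 s.

Lemma lsum_le {A} (f g : A -> R) s :
  (forall a, In a s -> f a <= g a) -> lsum f s <= lsum g s.
Proof.
  intros Hfg; induction s as [|a s IH]; simpl in *; [lra|].
  apply Rplus_le_compat; auto.
Qed.

Lemma lsum_ext {A} (f g : A -> R) s : (forall a, f a = g a) -> lsum f s = lsum g s.
Proof. intros Hfg; apply Rle_antisym; apply lsum_le; intros a _; rewrite Hfg; lra. Qed.

Lemma lsum_const {A} c (s : list A) : lsum (fun _ => c) s = INR (length s) * c.
Proof.
  induction s as [|a s IH]; cbn [length]; [simpl; ring|].
  rewrite S_INR; simpl; rewrite IH; ring.
Qed.

Lemma lsum_ge0 {A} (f : A -> R) s : (forall a, 0 <= f a) -> 0 <= lsum f s.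
Proof.
  intros Hf; rewrite <- (Rmult_0_r (INR (length s))), <- lsum_const.
  now apply lsum_le.
Qed.

Lemma lsum_scal {A} c (f : A -> R) s : lsum (fun a => c * f a) s = c * lsum f s.
Proof. induction s as [|a s IH]; simpl; [|rewrite IH]; ring. Qed.

Lemma lsum_plus {A} (f g : A -> R) s : lsum (fun a => f a + g a) s = lsum f s + lsum g s.
Proof. induction s as [|a s IH]; simpl; [|rewrite IH]; ring. Qed.

Lemma lsum_app {A} (f : A -> R) s t : lsum f (s ++ t) = lsum f s + lsum f t.
Proof. induction s as [|a s IH]; simpl; [|rewrite IH]; ring. Qed.

Lemma lsum_map {A B} (f : B -> R) (g : A -> B) s :
  lsum f (map g s) = lsum (fun a => f (g a)) s.
Proof. induction s as [|a s IH]; simpl; [|rewrite IH]; ring. Qed.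

Lemma lsum_filter {A} (f : A -> R) (b : A -> bool) s :
  lsum f (filter b s) = lsum (fun a => if b a then f a else 0) s.
Proof. induction s as [|a s IH]; simpl; [|destruct (b a); simpl; rewrite IH]; ring. Qed.

Lemma lsum_list_prod {A B} (f : A -> R) (g : B -> R) s t :
  lsum (fun p => f (fst p) * g (snd p)) (list_prod s t) = lsum f s * lsum g t.
Proof.
  induction s as [|a s IH]; simpl; [ring|].
  rewrite lsum_app, lsum_map, IH; simpl; rewrite lsum_scal; ring.
Qed.

Lemma lsum_le_incl {A} (f : A -> R) s t : (forall a, 0 <= f a) -> NoDup s ->
  (forall a, In a s -> f a <> 0 -> In a t) -> lsum f s <= lsum f t.
Proof.
  intros Hf Hs; revert t; induction Hs as [|a s Ha Hs IH]; intros t Hst; simpl.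
  - now apply lsum_ge0.
  - destruct (Req_dec (f a) 0) as [Hfa|Hfa].
    + assert (lsum f s <= lsum f t) by (apply IH; intros; apply Hst; simpl; auto). lra.
    + destruct (in_split a t) as (t1 & t2 & ->); [apply Hst; simpl; auto|].
      assert (lsum f s <= lsum f (t1 ++ t2)) as Hle.
      { apply IH; intros b Hb Hfb.
        assert (Hbt := Hst b (or_intror Hb) Hfb); rewrite in_app_iff in *.
        destruct Hbt as [|[->|]]; auto. contradiction. }
      rewrite lsum_app in *; simpl; lra.
Qed.

Lemma Cnorm2_ge0 a : 0 <= Cnorm2 a.
Proof. apply Rplus_le_le_0_compat; apply Rle_0_sqr. Qed.

Lemma Cnorm2_C0 : Cnorm2 C0 = 0.
Proof. unfold Cnorm2; simpl; ring. Qed.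

Lemma Cnorm2_RtoC r : Cnorm2 (RtoC r) = r ^ 2.
Proof. unfold Cnorm2; simpl; ring. Qed.

Lemma Cnorm2_add a b : Cnorm2 (Cadd a b) <= 2 * Cnorm2 a + 2 * Cnorm2 b.
Proof.
  unfold Cnorm2, Cadd; simpl.
  generalize (Rle_0_sqr (fst a - fst b)) (Rle_0_sqr (snd a - snd b)); unfold Rsqr; lra.
Qed.

Lemma Cnorm2_mul a b : Cnorm2 (Cmul a b) = Cnorm2 a * Cnorm2 b.
Proof. unfold Cnorm2; simpl; ring. Qed.

Ltac C_components :=
  unfold Cadd, Cmul, Copp, C0, RtoC; apply injective_projections; simpl.

Ltac C_ring := C_components; ring.

Definition sqsum_le {I : Type} (f : I -> C) (B : R) : Prop :=
  forall s, NoDup s -> lsum (fun i => Cnorm2 (f i)) s <= B.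

Lemma sqsum_le_ge0 {I} (f : I -> C) B : sqsum_le f B -> 0 <= B.
Proof. intros Hf; apply (Hf []); constructor. Qed.

Lemma sqsum_le_weaken {I} (f : I -> C) A B : sqsum_le f A -> A <= B -> sqsum_le f B.
Proof. intros Hf HAB s Hs; specialize (Hf s Hs); lra. Qed.

Lemma sqsum_le_zero {I} : sqsum_le (fun _ : I => C0) 0.
Proof. intros s _; rewrite lsum_const, Cnorm2_C0; lra. Qed.

Lemma sqsum_le_add {I} (f g : I -> C) A B : sqsum_le f A -> sqsum_le g B ->
  sqsum_le (fun i => Cadd (f i) (g i)) (2 * A + 2 * B).
Proof.
  intros Hf Hg s Hs.
  apply Rle_trans with (lsum (fun i => 2 * Cnorm2 (f i) + 2 * Cnorm2 (g i)) s).
  - apply lsum_le; intros; apply Cnorm2_add.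
  - rewrite lsum_plus, !lsum_scal; specialize (Hf s Hs); specialize (Hg s Hs); lra.
Qed.

Lemma sqsum_le_scale {I} c (f : I -> C) A : sqsum_le f A ->
  sqsum_le (fun i => Cmul c (f i)) (Cnorm2 c * A).
Proof.
  intros Hf s Hs; rewrite (lsum_ext _ _ _ (fun i => Cnorm2_mul c (f i))), lsum_scal.
  apply Rmult_le_compat_l; [apply Cnorm2_ge0|auto].
Qed.

Lemma sqsum_le_reindex {I J} (f : J -> C) (g : I -> C) (r : I -> J) A : Injective r ->
  (forall i, g i = f (r i)) -> sqsum_le f A -> sqsum_le g A.
Proof.
  intros Hr Hg Hf s Hs.
  rewrite (lsum_ext _ (fun i => Cnorm2 (f (r i)))) by (intros; now rewrite Hg).
  rewrite <- (lsum_map (fun j => Cnorm2 (f j)) r); now apply Hf, Injective_map_NoDup.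
Qed.

(* A partial sum close to the supremum leaves a small remainder. *)
Lemma sqsum_le_tail {I} (I_eq_dec : forall i j : I, {i = j} + {i <> j})
  (f : I -> C) B eps : sqsum_le f B -> 0 < eps ->
  exists s, NoDup s /\ sqsum_le (fun i => if in_dec I_eq_dec i s then C0 else f i) eps.
Proof.
  intros Hf Heps; set (norm2 := fun i => Cnorm2 (f i)).
  destruct (completeness (fun r => exists s, NoDup s /\ r = lsum norm2 s))
    as [sup [sup_ub sup_least]].
  - exists B; intros r (s & Hs & ->); auto.
  - exists 0, []; split; [constructor|reflexivity].
  - assert (exists s, NoDup s /\ sup - eps < lsum norm2 s) as (s & Hs & Hlarge).
    { apply NNPP; intros Hnone.
      assert (sup <= sup - eps); [|lra].
      apply sup_least; intros r (s & Hs & ->).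
      apply Rnot_lt_le; intros Hlt; apply Hnone; eauto. }
    exists s; split; [assumption|intros t Ht].
    set (outside := fun i => if in_dec I_eq_dec i s then false else true).
    rewrite (lsum_ext _ (fun i => if outside i then norm2 i else 0)), <- lsum_filter.
    2:{ intros i; unfold outside; destruct (in_dec I_eq_dec i s);
          [apply Cnorm2_C0|reflexivity]. }
    enough (lsum norm2 (s ++ filter outside t) <= sup) by (rewrite lsum_app in *; lra).
    apply sup_ub; eexists; split; [|reflexivity].
    apply NoDup_app; [assumption|now apply NoDup_filter|].
    intros i Hi Hit; apply filter_In in Hit; destruct Hit as [_ Hit].
    unfold outside in Hit; destruct (in_dec I_eq_dec i s); [discriminate|contradiction].
Qed.

(** * The Hilbert space and its closed subspaces *)

Definition idx : Type := (Z + nat * nat)%type.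

Definition idx_eq_dec (i j : idx) : {i = j} + {i <> j}.
Proof. decide equality; [apply Z.eq_dec|decide equality; apply Nat.eq_dec]. Defined.

Definition entry (x : vec) (i : idx) : C :=
  match i with inl z => fst x z | inr (j, n) => snd x j n end.

Lemma entry_add x y i : entry (vadd x y) i = Cadd (entry x i) (entry y i).
Proof. destruct i as [z|[j n]]; reflexivity. Qed.

Lemma entry_scale c x i : entry (vscale c x) i = Cmul c (entry x i).
Proof. destruct i as [z|[j n]]; reflexivity. Qed.

Lemma vec_ext (x y : vec) : (forall i, entry x i = entry y i) -> x = y.
Proof.
  intros Hxy; apply injective_projections.
  - apply functional_extensionality; intros z; apply (Hxy (inl z)).
  - do 2 (apply functional_extensionality; intros ?); apply (Hxy (inr (_, _))).
Qed.

Ltac vec_ring := apply vec_ext; intros [?|[? ?]]; simpl; C_ring.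

(* Entries in the copies [j >= k] do not count in [energy]. *)
Definition coord (k : nat) (x : vec) (i : idx) : C :=
  match i with
  | inr (j, _) => if (j <? k)%nat then entry x i else C0
  | inl _ => entry x i
  end.

Lemma coord_outside k x j n : (k <= j)%nat -> coord k x (inr (j, n)) = C0.
Proof. intros Hj; unfold coord; now rewrite (proj2 (Nat.ltb_ge j k) Hj). Qed.

Lemma coord_add k x y i : coord k (vadd x y) i = Cadd (coord k x i) (coord k y i).
Proof. destruct i as [z|[j n]]; simpl; [|destruct (j <? k)%nat]; C_ring. Qed.

Lemma coord_scale k c x i : coord k (vscale c x) i = Cmul c (coord k x i).
Proof. destruct i as [z|[j n]]; simpl; [|destruct (j <? k)%nat]; C_ring. Qed.

Notation norm2_le k x B := (sqsum_le (coord k x) B).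

Lemma energy_lsum k x l m :
  energy k x l m = lsum (fun i => Cnorm2 (coord k x i)) (map inl l ++ map inr m).
Proof.
  rewrite lsum_app, !lsum_map; unfold energy; f_equal.
  - induction l as [|z l IH]; simpl in *; [reflexivity|now rewrite IH].
  - induction m as [|[j n] m IH]; simpl in *; [reflexivity|]. rewrite IH.
    destruct (j <? k)%nat; [|rewrite Cnorm2_C0]; reflexivity.
Qed.

Lemma norm2_le_iff_energy k x B :
  norm2_le k x B <-> forall l m, NoDup l -> NoDup m -> energy k x l m <= B.
Proof.
  split; [intros Hx l m Hl Hm|intros Hx s Hs].
  - rewrite energy_lsum; apply Hx, NoDup_app.
    1,2: apply Injective_map_NoDup; [intros i j; congruence|assumption].
    intros i Hi Hj; apply in_map_iff in Hi, Hj.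
    destruct Hi as (? & <- & _), Hj as (? & ? & _); discriminate.
  - set (l := flat_map (fun i : idx => match i with inl z => [z] | inr _ => [] end) s).
    set (m := flat_map (fun i : idx => match i with inl _ => [] | inr p => [p] end) s).
    assert (dec : forall p q : nat * nat, {p = q} + {p <> q})
      by (decide equality; apply Nat.eq_dec).
    eapply Rle_trans; [|apply (Hx (nodup Z.eq_dec l) (nodup dec m)); apply NoDup_nodup].
    rewrite energy_lsum; apply lsum_le_incl; [intros; apply Cnorm2_ge0|assumption|].
    intros [z|p] Hi _; apply in_or_app; [left|right];
      apply in_map, nodup_In, in_flat_map; eexists; split; try exact Hi; simpl; auto.
Qed.

Lemma norm2_le_add k x y A B :
  norm2_le k x A -> norm2_le k y B -> norm2_le k (vadd x y) (2 * A + 2 * B).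
Proof.
  rewrite (functional_extensionality _ _ (coord_add k x y)); apply sqsum_le_add.
Qed.

Lemma norm2_le_scale k c x A :
  norm2_le k x A -> norm2_le k (vscale c x) (Cnorm2 c * A).
Proof.
  rewrite (functional_extensionality _ _ (coord_scale k c x)); apply sqsum_le_scale.
Qed.

Lemma norm2_le_zero k : norm2_le k vzero 0.
Proof.
  replace (coord k vzero) with (fun _ : idx => C0); [apply sqsum_le_zero|].
  apply functional_extensionality; intros [z|[j n]]; simpl;
    [|destruct (j <? k)%nat]; reflexivity.
Qed.

Lemma norm2_le_Top k x A : norm2_le k x A -> norm2_le k (Top x) A.
Proof.
  apply (sqsum_le_reindex _ _ (fun i : idx => match i with
    | inl z => inl (z - 1)%Z | inr (j, n) => inr (j, S n) end)).
  - intros [y|[i m]] [z|[j n]] Heq; try discriminate; injection Heq; intros;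
      f_equal; try f_equal; lia.
  - intros [z|[j n]]; reflexivity.
Qed.

Definition zshift (n : Z) (x : vec) : vec := (fun z => fst x (z - n)%Z, snd x).

Lemma norm2_le_zshift k n x A : norm2_le k x A -> norm2_le k (zshift n x) A.
Proof.
  apply (sqsum_le_reindex _ _ (fun i : idx => match i with
    | inl z => inl (z - n)%Z | inr p => inr p end)).
  - intros [y|p] [z|q] Heq; try discriminate; injection Heq; intros;
      f_equal; [lia|assumption].
  - intros [z|[j m]]; reflexivity.
Qed.

Lemma half_pow_bounds n : 0 < (1/2)^n <= 1.
Proof. induction n as [|n IH]; simpl; lra. Qed.

Lemma mult_half_pow_ge0 D n : 0 <= D -> 0 <= D * (1/2)^n.
Proof. intros HD; apply Rmult_le_pos; [assumption|apply Rlt_le, half_pow_bounds]. Qed.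

Lemma lsum_half_pow_seq N s : lsum (pow (1/2)) (List.seq s N) <= 2 * (1/2)^s.
Proof.
  revert s; induction N as [|N IH]; intros s; simpl.
  - generalize (half_pow_bounds s); lra.
  - specialize (IH (S s)); simpl in IH; lra.
Qed.

Lemma norm2_le_geometric k x D : 0 <= D -> (forall z, fst x z = C0) ->
  (forall j n, (j < k)%nat -> Cnorm2 (snd x j n) <= D * (1/2)^n) ->
  norm2_le k x (2 * INR k * D).
Proof.
  intros HD Hfst Hsnd s Hs.
  set (position := fun i : idx => match i with inl _ => O | inr p => snd p end).
  set (N := S (list_max (map position s))).
  set (grid := list_prod (List.seq 0 k) (List.seq 0 N)).
  apply Rle_trans with (lsum (fun i => Cnorm2 (coord k x i)) (map inr grid)).
  - apply lsum_le_incl; [intros; apply Cnorm2_ge0|assumption|].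
    intros [z|[j n]] Hi Hne; [destruct Hne; simpl; rewrite Hfst; apply Cnorm2_C0|].
    apply in_map, in_prod; apply in_seq; split; try lia.
    + apply Nat.nle_gt; intros Hj; apply Hne; rewrite coord_outside by assumption.
      apply Cnorm2_C0.
    + unfold N; apply Nat.lt_succ_r.
      apply (proj1 (Forall_forall _ _) (proj1 (list_max_le _ _) (Nat.le_refl _))).
      apply (in_map position _ _ Hi).
  - rewrite lsum_map.
    apply Rle_trans with (lsum (fun p => D * (1/2) ^ (snd p)) grid).
    + apply lsum_le; intros [j n] Hjn; apply in_prod_iff in Hjn.
      destruct Hjn as [Hj _]; apply in_seq in Hj; simpl.
      rewrite (proj2 (Nat.ltb_lt j k)) by lia. apply Hsnd; lia.
    + unfold grid; rewrite (lsum_list_prod (fun _ => D)), lsum_const, length_seq.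
      generalize (lsum_half_pow_seq N 0) (pos_INR k); simpl; intros.
      assert (0 <= INR k * D) by now apply Rmult_le_pos. nra.
Qed.

Record closed_subspace (k : nat) (M : vec -> Prop) : Prop := {
  closed_subspace_zero : M vzero;
  closed_subspace_add : forall x y, M x -> M y -> M (vadd x y);
  closed_subspace_scale : forall c x, M x -> M (vscale c x);
  closed_subspace_limit : forall x,
    (forall eps, 0 < eps -> exists y, M y /\ norm2_le k (vsub x y) eps) -> M x }.

Arguments closed_subspace_zero {k M}.
Arguments closed_subspace_add {k M}.
Arguments closed_subspace_scale {k M}.
Arguments closed_subspace_limit {k M}.

Definition Top_invariant (M : vec -> Prop) : Prop := forall x, M x -> M (Top x).

Lemma vsub_scale x y : vsub x y = vadd x (vscale (RtoC (-1)) y).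
Proof. vec_ring. Qed.

Definition basis (i : idx) : vec :=
  (fun z => if idx_eq_dec (inl z) i then RtoC 1 else C0,
   fun j n => if idx_eq_dec (inr (j, n)) i then RtoC 1 else C0).

Lemma entry_basis a i : entry (basis a) i = if idx_eq_dec i a then RtoC 1 else C0.
Proof. destruct i as [z|[j n]]; reflexivity. Qed.

Definition basis_comb (f : idx -> C) (s : list idx) : vec :=
  fold_right (fun i y => vadd (vscale (f i) (basis i)) y) vzero s.

Lemma entry_basis_comb f s i : NoDup s ->
  entry (basis_comb f s) i = if in_dec idx_eq_dec i s then f i else C0.
Proof.
  induction 1 as [|a s Ha Hs IH]; [now destruct i as [|[]]|].
  cbn [basis_comb fold_right]; rewrite entry_add, entry_scale, entry_basis.
  fold (basis_comb f s); rewrite IH.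
  destruct (idx_eq_dec i a) as [->|Hne].
  - destruct (in_dec idx_eq_dec a s), (in_dec idx_eq_dec a (a :: s)) as [|Hin];
      try contradiction; [C_ring|now destruct Hin; left].
  - destruct (in_dec idx_eq_dec i s) as [|Hs'], (in_dec idx_eq_dec i (a :: s)) as [Hin|Hin];
      try C_ring; [now destruct Hin; right|].
    destruct Hin; [congruence|contradiction].
Qed.

Section ClosedSubspace.

Context {k : nat} {M : vec -> Prop} (M_closed : closed_subspace k M).

Lemma closed_subspace_sub x y : M x -> M y -> M (vsub x y).
Proof.
  intros Hx Hy; rewrite vsub_scale.
  apply (closed_subspace_add M_closed), (closed_subspace_scale M_closed); assumption.
Qed.

Lemma closed_subspace_basis_support x B : norm2_le k x B ->
  (forall i, coord k x i <> C0 -> M (basis i)) -> M x.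
Proof.
  intros Hx Hbasis; apply (closed_subspace_limit M_closed); intros eps Heps.
  destruct (sqsum_le_tail idx_eq_dec (coord k x) B eps Hx Heps) as (s & Hs & Htail).
  exists (basis_comb (coord k x) s); split.
  - clear Hs Htail; induction s as [|i s IH]; simpl;
      [apply (closed_subspace_zero M_closed)|].
    apply (closed_subspace_add M_closed); [|assumption].
    destruct (excluded_middle_informative (coord k x i = C0)) as [->|Hi].
    + replace (vscale C0 (basis i)) with vzero; [apply (closed_subspace_zero M_closed)|].
      generalize (basis i); intros; vec_ring.
    + apply (closed_subspace_scale M_closed); auto.
  - replace (coord k (vsub x _))
      with (fun i => if in_dec idx_eq_dec i s then C0 else coord k x i); [assumption|].
    apply functional_extensionality; intros i.
    assert (Hcomb := entry_basis_comb (coord k x) s i Hs).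
    destruct (in_dec idx_eq_dec i s) as [Hi|Hi]; destruct i as [z|[j n]]; simpl in *;
      try destruct (j <? k)%nat; rewrite ?Hcomb; try C_ring.
Qed.

End ClosedSubspace.

(** * Cyclic subspaces and polynomials in the operator *)

Definition orbit_span (h x : vec) : Prop := exists N c, x = lincomb c h N.

Lemma lincomb_pad c h N M : (N <= M)%nat ->
  lincomb c h N = lincomb (fun n => if (n <=? N)%nat then c n else C0) h M.
Proof.
  induction 1 as [|M HNM IH].
  - enough (forall n, (n <= N)%nat ->
      lincomb c h n = lincomb (fun n => if (n <=? N)%nat then c n else C0) h n) by auto.
    induction n as [|n IH]; intros Hn; cbn [lincomb];
      rewrite (proj2 (Nat.leb_le _ _) Hn); [reflexivity|].
    now rewrite IH by lia.
  - cbn [lincomb]; rewrite <- IH, (proj2 (Nat.leb_gt (S M) N)) by lia.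
    generalize (Tpow (S M) h); intros; vec_ring.
Qed.

Lemma lincomb_add c d h N :
  vadd (lincomb c h N) (lincomb d h N) = lincomb (fun n => Cadd (c n) (d n)) h N.
Proof.
  induction N as [|N IH]; [vec_ring|]. cbn [lincomb]; rewrite <- IH.
  generalize (Tpow (S N) h); intros; vec_ring.
Qed.

Lemma lincomb_scale a c h N :
  vscale a (lincomb c h N) = lincomb (fun n => Cmul a (c n)) h N.
Proof.
  induction N as [|N IH]; [vec_ring|]. cbn [lincomb]; rewrite <- IH.
  generalize (Tpow (S N) h); intros; vec_ring.
Qed.

Lemma lincomb_Top c h N :
  Top (lincomb c h N) = lincomb (fun n => match n with O => C0 | S n => c n end) h (S N).
Proof.
  set (d := fun n => _); induction N as [|N IH]; [vec_ring|].
  change (lincomb d h (S (S N)))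
    with (vadd (lincomb d h (S N)) (vscale (c (S N)) (Top (Tpow (S N) h)))).
  rewrite <- IH; cbn [lincomb]; generalize (Tpow (S N) h); intros; vec_ring.
Qed.

Lemma orbit_span_self h : orbit_span h h.
Proof. exists 0%nat, (fun _ => RtoC 1); vec_ring. Qed.

Lemma orbit_span_add h x y : orbit_span h x -> orbit_span h y -> orbit_span h (vadd x y).
Proof.
  intros (N & c & ->) (M & d & ->).
  rewrite (lincomb_pad c h N (N + M)), (lincomb_pad d h M (N + M)), lincomb_add by lia.
  unfold orbit_span; eauto.
Qed.

Lemma orbit_span_scale h a x : orbit_span h x -> orbit_span h (vscale a x).
Proof. intros (N & c & ->); rewrite lincomb_scale; unfold orbit_span; eauto. Qed.

Lemma orbit_span_Top h : Top_invariant (orbit_span h).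
Proof. intros x (N & c & ->); rewrite lincomb_Top; unfold orbit_span; eauto. Qed.

Definition cyclic_subspace (k : nat) (h x : vec) : Prop :=
  forall eps, 0 < eps -> exists y, orbit_span h y /\ norm2_le k (vsub x y) eps.

Lemma orbit_span_cyclic_subspace k h x : orbit_span h x -> cyclic_subspace k h x.
Proof.
  intros Hx eps Heps; exists x; split; [assumption|].
  replace (vsub x x) with vzero by vec_ring.
  apply sqsum_le_weaken with 0; [apply norm2_le_zero|lra].
Qed.

Lemma cyclic_subspace_self k h : cyclic_subspace k h h.
Proof. apply orbit_span_cyclic_subspace, orbit_span_self. Qed.

Lemma closed_subspace_cyclic k h : closed_subspace k (cyclic_subspace k h).
Proof.
  split.
  - apply orbit_span_cyclic_subspace.
    replace vzero with (vscale C0 h) by vec_ring.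
    apply orbit_span_scale, orbit_span_self.
  - intros x y Hx Hy eps Heps.
    destruct (Hx (eps / 4)) as (x' & Hx' & Hxx'); [lra|].
    destruct (Hy (eps / 4)) as (y' & Hy' & Hyy'); [lra|].
    exists (vadd x' y'); split; [now apply orbit_span_add|].
    replace (vsub _ _) with (vadd (vsub x x') (vsub y y')) by vec_ring.
    eapply sqsum_le_weaken; [apply norm2_le_add; eassumption|lra].
  - intros c x Hx eps Heps. assert (Hc := Cnorm2_ge0 c).
    destruct (Hx (eps / (Cnorm2 c + 1))) as (x' & Hx' & Hxx').
    { apply Rdiv_lt_0_compat; lra. }
    exists (vscale c x'); split; [now apply orbit_span_scale|].
    replace (vsub _ _) with (vscale c (vsub x x')) by vec_ring.
    eapply sqsum_le_weaken; [apply norm2_le_scale; eassumption|].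
    apply Rmult_le_reg_r with (Cnorm2 c + 1); [lra|].
    field_simplify; [nra|lra].
  - intros x Hx eps Heps.
    destruct (Hx (eps / 4)) as (y & Hy & Hxy); [lra|].
    destruct (Hy (eps / 4)) as (z & Hz & Hyz); [lra|].
    exists z; split; [assumption|].
    replace (vsub x z) with (vadd (vsub x y) (vsub y z)) by vec_ring.
    eapply sqsum_le_weaken; [apply norm2_le_add; eassumption|lra].
Qed.

Lemma Top_invariant_cyclic k h : Top_invariant (cyclic_subspace k h).
Proof.
  intros x Hx eps Heps. destruct (Hx eps Heps) as (y & Hy & Hxy).
  exists (Top y); split; [now apply orbit_span_Top|].
  now apply (norm2_le_Top k (vsub x y)).
Qed.

Lemma cyclic_of_cyclic_subspace_total k h : inH k h ->
  (forall x, inH k x -> cyclic_subspace k h x) -> cyclic_T k.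
Proof.
  intros Hh Htotal; exists h; split; [assumption|intros x Hx eps Heps].
  destruct (Htotal x Hx (eps / 2 * (eps / 2))) as (y & (N & c & ->) & Hxy); [nra|].
  exists N, c, (eps / 2); split; [lra|split; [lra|]].
  now apply norm2_le_iff_energy.
Qed.

(* Syntax trees, so that one polynomial can be evaluated both at complex numbers
   and at the operator. *)
Inductive poly : Type :=
| PConst (c : C)
| PX
| PAdd (p q : poly)
| PMul (p q : poly).

Fixpoint peval (p : poly) (z : C) : C :=
  match p with
  | PConst c => c
  | PX => z
  | PAdd p q => Cadd (peval p z) (peval q z)
  | PMul p q => Cmul (peval p z) (peval q z)
  end.

Fixpoint papply (p : poly) (x : vec) : vec :=
  match p with
  | PConst c => vscale c x
  | PX => Top x
  | PAdd p q => vadd (papply p x) (papply q x)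
  | PMul p q => papply p (papply q x)
  end.

Fixpoint pbound (p : poly) : R :=
  match p with
  | PConst c => 1 + Cnorm2 c
  | PX => 1
  | PAdd p q => 2 * pbound p + 2 * pbound q
  | PMul p q => pbound p * pbound q
  end.

Lemma pbound_ge1 p : 1 <= pbound p.
Proof.
  induction p as [c| |p IHp q IHq|p IHp q IHq]; simpl; try nra.
  generalize (Cnorm2_ge0 c); lra.
Qed.

Lemma Cnorm2_peval_le p z : Cnorm2 z <= 1 -> Cnorm2 (peval p z) <= pbound p.
Proof.
  intros Hz; induction p as [c| |p IHp q IHq|p IHp q IHq]; simpl; try lra.
  - generalize (Cnorm2_add (peval p z) (peval q z)); lra.
  - rewrite Cnorm2_mul; apply Rmult_le_compat; auto using Cnorm2_ge0.
Qed.

Lemma norm2_le_papply k p x A : norm2_le k x A -> norm2_le k (papply p x) (pbound p * A).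
Proof.
  revert x A; induction p as [c| |p IHp q IHq|p IHp q IHq]; intros x A Hx; simpl.
  - apply sqsum_le_weaken with (Cnorm2 c * A); [now apply norm2_le_scale|].
    generalize (sqsum_le_ge0 _ _ Hx); lra.
  - rewrite Rmult_1_l; now apply norm2_le_Top.
  - apply sqsum_le_weaken with (2 * (pbound p * A) + 2 * (pbound q * A)); [|lra].
    apply norm2_le_add; auto.
  - rewrite Rmult_assoc; auto.
Qed.

Lemma papply_add p x y : papply p (vadd x y) = vadd (papply p x) (papply p y).
Proof.
  revert x y; induction p as [c| |p IHp q IHq|p IHp q IHq]; intros x y; cbn [papply].
  - vec_ring.
  - vec_ring.
  - rewrite IHp, IHq; vec_ring.
  - now rewrite IHq, IHp.
Qed.

Lemma papply_commute p (A : vec -> vec) x :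
  (forall y z, A (vadd y z) = vadd (A y) (A z)) ->
  (forall c y, A (vscale c y) = vscale c (A y)) ->
  (forall y, A (Top y) = Top (A y)) ->
  papply p (A x) = A (papply p x).
Proof.
  intros A_add A_scale A_Top.
  revert x; induction p as [c| |p IHp q IHq|p IHp q IHq]; intros x; cbn [papply]; auto.
  - now rewrite IHp, IHq.
  - now rewrite IHq, IHp.
Qed.

Lemma papply_scale p c x : papply p (vscale c x) = vscale c (papply p x).
Proof. apply (papply_commute p (vscale c)); intros; vec_ring. Qed.

Lemma zshift_Top n x : zshift n (Top x) = Top (zshift n x).
Proof. apply vec_ext; intros [z|[j m]]; simpl; [f_equal; lia|reflexivity]. Qed.

Lemma papply_zshift p n x : papply p (zshift n x) = zshift n (papply p x).
Proof.
  apply (papply_commute p (zshift n)); [intros; vec_ring|intros; vec_ring|].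
  apply zshift_Top.
Qed.

Lemma papply_divide_X p :
  exists q, forall x, papply p x = vadd (vscale (peval p C0) x) (papply q (Top x)).
Proof.
  induction p as [c| |p [p' IHp] q [q' IHq]|p [p' IHp] q [q' IHq]]; cbn [papply peval].
  - exists (PConst C0); intros x; vec_ring.
  - exists (PConst (RtoC 1)); intros x; vec_ring.
  - exists (PAdd p' q'); intros x; rewrite IHp, IHq; cbn [papply]; vec_ring.
  - exists (PAdd (PMul p q') (PMul (PConst (peval q C0)) p')); intros x.
    rewrite IHq, papply_add, papply_scale, (IHp x); cbn [papply]; vec_ring.
Qed.

Section InvariantSubspace.

Context {k : nat} {M : vec -> Prop}.
Hypotheses (M_closed : closed_subspace k M) (M_Top : Top_invariant M).

Lemma invariant_Tpow s x : M x -> M (Tpow s x).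
Proof. intros Hx; induction s as [|s IH]; [exact Hx|now apply (M_Top (Tpow s x))]. Qed.

Lemma invariant_papply p x : M x -> M (papply p x).
Proof.
  revert x; induction p as [c| |p IHp q IHq|p IHp q IHq]; intros x Hx; cbn [papply]; auto.
  - now apply (closed_subspace_scale M_closed).
  - apply (closed_subspace_add M_closed); auto.
Qed.

Lemma invariant_of_Top y : M (Top y) ->
  (forall eps, 0 < eps -> exists p w,
     peval p C0 = RtoC 1 /\ M w /\ norm2_le k (vsub (papply p y) w) eps) ->
  M y.
Proof.
  intros HTy Happrox; apply (closed_subspace_limit M_closed); intros eps Heps.
  destruct (Happrox eps Heps) as (p & w & Hp0 & Hw & Hpw).
  destruct (papply_divide_X p) as [q Hq].
  exists (vsub w (papply q (Top y))); split.
  - apply (closed_subspace_sub M_closed); [|apply invariant_papply]; assumption.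
  - replace (vsub y _) with (vsub (papply p y) w); [assumption|].
    rewrite Hq, Hp0; generalize (papply q (Top y)); intros; vec_ring.
Qed.

End InvariantSubspace.

(** * Vectors nearly annihilated by polynomials with constant term 1 *)

Lemma entry_Tpow s x i : entry (Tpow s x) i =
  entry x (match i with
           | inl z => inl (z - Z.of_nat s)%Z
           | inr (j, n) => inr (j, (s + n)%nat) end).
Proof.
  revert i; induction s as [|s IH]; intros i.
  - destruct i as [z|[j n]]; simpl; [f_equal; lia|reflexivity].
  - change (Tpow (S s) x) with (Top (Tpow s x)).
    destruct i as [z|[j n]]; [specialize (IH (inl (z - 1)%Z))|specialize (IH (inr (j, S n)))];
      cbn [entry Top fst snd] in *; rewrite IH; f_equal; lia.
Qed.

Definition bilateral (U : vec) : Prop := forall j n, snd U j n = C0.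

Lemma Tpow_bilateral s U : bilateral U -> Tpow s U = zshift (Z.of_nat s) U.
Proof.
  intros HU; apply vec_ext; intros i; rewrite entry_Tpow.
  destruct i as [z|[j n]]; [reflexivity|]. simpl; now rewrite !HU.
Qed.

Definition annihilable (k : nat) (U : vec) : Prop :=
  forall eps, 0 < eps -> exists p, peval p C0 = RtoC 1 /\ norm2_le k (papply p U) eps.

Lemma invariant_zshift k M U i : closed_subspace k M -> Top_invariant M ->
  bilateral U -> annihilable k U -> M U -> M (zshift i U).
Proof.
  intros M_closed M_Top HU Hann HMU.
  destruct (Z.le_gt_cases 0 i) as [Hi|Hi].
  - rewrite <- (Z2Nat.id i), <- Tpow_bilateral by assumption; now apply invariant_Tpow.
  - replace i with (- Z.of_nat (Z.to_nat (- i)))%Z by lia.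
    induction (Z.to_nat (- i)) as [|n IH].
    + replace (zshift _ U) with U; [assumption|].
      apply vec_ext; intros [z|[j n]]; simpl; [f_equal; lia|reflexivity].
    + apply (invariant_of_Top M_closed M_Top).
      * replace (Top _) with (zshift (- Z.of_nat n) U); [assumption|].
        apply vec_ext; intros [z|[j m]]; cbn [entry Top zshift fst snd];
          [f_equal; lia|now rewrite !HU].
      * intros eps Heps; destruct (Hann eps Heps) as (p & Hp0 & Hp).
        exists p, vzero; split; [assumption|split; [apply (closed_subspace_zero M_closed)|]].
        replace (vsub _ vzero) with (zshift (- Z.of_nat (S n)) (papply p U));
          [now apply norm2_le_zshift|].
        rewrite papply_zshift; generalize (papply p U); intros; vec_ring.
Qed.

(** * Coupling the bilateral shift with the backward shifts *)

Lemma pow2_half_pow n : 2^n * (1/2)^n = 1.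
Proof. rewrite <- Rpow_mult_distr; replace (2 * (1/2)) with 1 by lra; apply pow1. Qed.

Lemma half_pow_eventually_le A eps : 0 < eps ->
  exists N, forall m, (N <= m)%nat -> A * (1/2)^m <= eps.
Proof.
  intros Heps; assert (HA := Rabs_pos A).
  destruct (pow_lt_1_zero (1/2) ltac:(rewrite Rabs_pos_eq; lra) (eps / (Rabs A + 1)))
    as [N HN]; [apply Rdiv_lt_0_compat; lra|].
  exists N; intros m Hm; specialize (HN m Hm).
  generalize (half_pow_bounds m) (Rle_abs A); intros.
  rewrite Rabs_pos_eq in HN by lra; apply Rlt_div_r in HN; nra.
Qed.

Section Amplitudes.

Variable K : nat -> R -> R.
Hypothesis K_ge1 : forall i a, 1 <= K i a.

(* Each amplitude is negligible against the previous one even after magnification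
   by the factor attached to the latter. *)
Fixpoint amplitude (i : nat) : R :=
  match i with
  | O => 1
  | S i => amplitude i * ((1/2)^(3 * i + 1) / K i (amplitude i))
  end.

Lemma amplitude_pos i : 0 < amplitude i.
Proof.
  induction i as [|i IH]; cbn [amplitude]; [lra|].
  apply Rmult_lt_0_compat; [assumption|].
  specialize (K_ge1 i (amplitude i)); apply Rdiv_lt_0_compat; [apply half_pow_bounds|lra].
Qed.

Lemma amplitude_succ_sqr_le i :
  amplitude (S i) ^ 2 <= amplitude i ^ 2 * ((1/2)^(3 * i + 1) / K i (amplitude i)).
Proof.
  cbn [amplitude]; rewrite Rpow_mult_distr.
  apply Rmult_le_compat_l; [apply pow2_ge_0|].
  assert (HK := K_ge1 i (amplitude i)).
  assert (Hpow := half_pow_bounds (3 * i + 1)).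
  assert (Hratio : 0 < (1/2)^(3 * i + 1) / K i (amplitude i) <= 1).
  { split; [apply Rdiv_lt_0_compat; lra|apply Rle_div_l; lra]. }
  revert Hratio; generalize ((1/2)^(3 * i + 1) / K i (amplitude i)); intros r Hr.
  nra.
Qed.

Lemma amplitude_sqr_decay m i : (m < i)%nat ->
  amplitude i ^ 2
  <= amplitude m ^ 2 * (1/2)^m / K m (amplitude m) * (1/2)^(i * i - m * m).
Proof.
  induction 1 as [|i Hmi IH]; (eapply Rle_trans; [apply amplitude_succ_sqr_le|]).
  - replace (3 * m + 1)%nat with (m + (S m * S m - m * m))%nat by lia.
    rewrite pow_add; apply Req_le; specialize (K_ge1 m (amplitude m)); field; lra.
  - replace (S i * S i - m * m)%nat with ((i * i - m * m) + (2 * i + 1))%nat by nia.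
    rewrite (pow_add _ (i * i - m * m)), <- Rmult_assoc.
    assert (HK := K_ge1 i (amplitude i)).
    apply Rmult_le_compat; [apply pow2_ge_0| |assumption|].
    + apply Rdiv_le_0_compat; [apply Rlt_le, half_pow_bounds|lra].
    + apply Rle_div_l; [lra|].
      replace (3 * i + 1)%nat with ((2 * i + 1) + i)%nat by lia.
      rewrite (pow_add _ (2 * i + 1)).
      generalize (half_pow_bounds (2 * i + 1)) (half_pow_bounds i); nra.
Qed.

End Amplitudes.

Record coupling (k : nat) (U : vec) (a : nat -> R) (p : nat -> poly) : Prop := {
  coupling_pos : forall m, 0 < a m;
  coupling_const : forall m, peval (p m) C0 = RtoC 1;
  coupling_small : forall m, norm2_le k (papply (p m) U) (a m ^ 2 * (1/2)^m);
  coupling_decay : forall m i, (m < i)%nat ->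
    a i ^ 2 <= a m ^ 2 * (1/2)^m / pbound (p m) * (1/2)^(i * i - m * m) }.

Arguments coupling_pos {k U a p}.
Arguments coupling_const {k U a p}.
Arguments coupling_small {k U a p}.
Arguments coupling_decay {k U a p}.

Lemma coupling_exists k U : annihilable k U -> exists a p, coupling k U a p.
Proof.
  intros Hann.
  assert (exists P : R -> poly, forall eps, 0 < eps ->
    peval (P eps) C0 = RtoC 1 /\ norm2_le k (papply (P eps) U) eps) as [P HP].
  { apply (choice (fun eps p => 0 < eps ->
      peval p C0 = RtoC 1 /\ norm2_le k (papply p U) eps)).
    intros eps; destruct (Rlt_dec 0 eps) as [Heps|Heps].
    - destruct (Hann eps Heps) as [p Hp]; exists p; auto.
    - exists PX; intros; contradiction. }
  set (a := amplitude (fun i a => pbound (P (a ^ 2 * (1/2)^i)))).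
  assert (Ha : forall m, 0 < a m) by (apply amplitude_pos; intros; apply pbound_ge1).
  assert (Hsmall : forall m, 0 < a m ^ 2 * (1/2)^m).
  { intros m; apply Rmult_lt_0_compat; [apply pow_lt, Ha|apply half_pow_bounds]. }
  exists a, (fun m => P (a m ^ 2 * (1/2)^m)); split; [assumption| | |].
  - intros m; apply HP, Hsmall.
  - intros m; apply HP, Hsmall.
  - apply (amplitude_sqr_decay (fun i a => pbound (P (a ^ 2 * (1/2)^i)))).
    intros; apply pbound_ge1.
Qed.

(* Amplitude [a i] at position [i^2] of copy [i mod k]. *)
Definition lacunary (k : nat) (a : nat -> R) : vec :=
  (fun _ => C0,
   fun j n => let i := Nat.sqrt n in
     if Nat.eq_dec (i * i) n then if Nat.eq_dec (i mod k) j then RtoC (a i) else C0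
     else C0).

Lemma snd_lacunary_square k a i : snd (lacunary k a) (i mod k)%nat (i * i)%nat = RtoC (a i).
Proof.
  simpl; rewrite Nat.sqrt_square.
  destruct (Nat.eq_dec (i * i) (i * i)); [|contradiction].
  destruct (Nat.eq_dec (i mod k) (i mod k)); [reflexivity|contradiction].
Qed.

Lemma snd_lacunary_cases k a j n : snd (lacunary k a) j n = C0 \/
  exists i, n = (i * i)%nat /\ j = (i mod k)%nat /\ snd (lacunary k a) j n = RtoC (a i).
Proof.
  simpl; destruct (Nat.eq_dec _ n) as [Hn|]; [|now left].
  destruct (Nat.eq_dec _ j) as [Hj|]; [right; eauto|now left].
Qed.

Lemma snd_lacunary_outside k a j n : (1 <= k <= j)%nat -> snd (lacunary k a) j n = C0.
Proof.
  intros Hkj; destruct (snd_lacunary_cases k a j n) as [|(i & _ & Hj & _)]; [assumption|].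
  generalize (Nat.mod_upper_bound i k); lia.
Qed.

Lemma norm2_le_lacunary_tail k a D m n s : (n < m)%nat -> (m * m = s + n)%nat -> 0 <= D ->
  (forall i, (m < i)%nat -> a i ^ 2 <= D * (1/2)^(i * i - m * m)) ->
  norm2_le k (vsub (Tpow s (lacunary k a))
                (vscale (RtoC (a m)) (basis (inr ((m mod k)%nat, n)))))
    (2 * INR k * (D * 2^n)).
Proof.
  intros Hnm Hs HD Ha.
  assert (pow2_pos : 0 < 2^n) by (apply pow_lt; lra).
  assert (D_pow2_ge0 : 0 <= D * 2^n) by nra.
  apply norm2_le_geometric; [assumption| |].
  - intros z; assert (Hentry := entry_Tpow s (lacunary k a) (inl z)).
    simpl in *; rewrite Hentry; C_ring.
  - intros j n' _; assert (Hentry := entry_Tpow s (lacunary k a) (inr (j, n'))).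
    assert (Hbasis := entry_basis (inr ((m mod k)%nat, n)) (inr (j, n'))).
    cbn [entry] in Hentry, Hbasis; unfold vsub, vscale; cbn [snd].
    rewrite Hentry, Hbasis; clear Hentry Hbasis.
    destruct (idx_eq_dec (inr (j, n')) (inr ((m mod k)%nat, n))) as [Heq|Hne].
    + injection Heq as -> ->; rewrite <- Hs, snd_lacunary_square.
      replace (Cadd _ _) with C0 by C_ring; rewrite Cnorm2_C0; now apply mult_half_pow_ge0.
    + replace (Cadd _ _) with (snd (lacunary k a) j (s + n')%nat) by C_ring.
      destruct (snd_lacunary_cases k a j (s + n')%nat) as [->|(i & Hi & Hj & ->)];
        [rewrite Cnorm2_C0; now apply mult_half_pow_ge0|].
      assert (i <> m) by (intros ->; apply Hne; do 2 f_equal; lia).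
      assert (Hmi : (m < i)%nat) by nia.
      rewrite Cnorm2_RtoC; replace n' with (n + (i * i - m * m))%nat by nia.
      rewrite pow_add, <- Rmult_assoc, (Rmult_assoc D), pow2_half_pow, Rmult_1_r; auto.
Qed.

Section Coupling.

Context {k : nat} {U : vec} {a : nat -> R} {p : nat -> poly}.
Hypotheses (k_ge1 : (1 <= k)%nat) (U_bilateral : bilateral U) (U_coupled : coupling k U a p).

Let h : vec := vadd U (lacunary k a).

Lemma norm2_le_lacunary : norm2_le k (lacunary k a) (2 * INR k * a 0%nat ^ 2).
Proof.
  apply norm2_le_geometric; [apply pow2_ge_0|reflexivity|intros j n _].
  assert (Hn := mult_half_pow_ge0 _ n (pow2_ge_0 (a 0%nat))).
  destruct (snd_lacunary_cases k a j n) as [->|(i & -> & _ & ->)];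
    [now rewrite Cnorm2_C0|rewrite Cnorm2_RtoC].
  destruct i as [|i]; [simpl; lra|].
  eapply Rle_trans; [apply (coupling_decay U_coupled 0); lia|].
  rewrite Nat.sub_0_r; apply Rmult_le_compat_r; [apply Rlt_le, half_pow_bounds|].
  generalize (pbound_ge1 (p 0%nat)) (pow2_ge_0 (a 0%nat)); intros.
  apply Rle_div_l; [lra|]. simpl in *; nra.
Qed.

Lemma inH_coupled B : norm2_le k U B -> inH k h.
Proof.
  intros HB; split.
  - intros j n Hj; cbn [h vadd snd].
    rewrite U_bilateral, snd_lacunary_outside by lia; C_ring.
  - eexists; apply norm2_le_iff_energy, norm2_le_add; [eassumption|].
    apply norm2_le_lacunary.
Qed.

Lemma Tpow_coupled s x : Tpow s h
  = vadd (vadd (zshift (Z.of_nat s) U) x) (vsub (Tpow s (lacunary k a)) x).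
Proof.
  rewrite <- (Tpow_bilateral s U U_bilateral); unfold h; apply vec_ext; intros i.
  rewrite entry_Tpow.
  assert (HU := entry_Tpow s U i); assert (HV := entry_Tpow s (lacunary k a) i).
  destruct i as [z|[j n]]; simpl in *; rewrite HU, HV; C_ring.
Qed.

Lemma norm2_le_papply_coupled m n : (n < m)%nat ->
  norm2_le k
    (vsub (papply (p m) (basis (inr ((m mod k)%nat, n))))
       (vscale (RtoC (/ a m)) (papply (p m) (Tpow (m * m - n)%nat h))))
    ((2 + 4 * INR k * 2^n) * (1/2)^m).
Proof.
  intros Hnm; set (s := (m * m - n)%nat).
  assert (Hs : (m * m = s + n)%nat) by (unfold s; nia); clearbody s.
  assert (Ha := coupling_pos U_coupled m). assert (Hb := pbound_ge1 (p m)).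
  assert (Hnear := norm2_le_zshift k (Z.of_nat s) _ _ (coupling_small U_coupled m)).
  assert (Htail := norm2_le_lacunary_tail k a (a m ^ 2 * (1/2)^m / pbound (p m)) m n s Hnm Hs).
  set (e := basis (inr ((m mod k)%nat, n))) in *; set (y := vsub _ _) in Htail.
  apply (norm2_le_papply k (p m)) in Htail.
  - rewrite (Tpow_coupled s (vscale (RtoC (a m)) e)); fold y; rewrite !papply_add, papply_scale, papply_zshift.
    replace (vsub _ _) with (vscale (RtoC (- / a m))
      (vadd (zshift (Z.of_nat s) (papply (p m) U)) (papply (p m) y))).
    2:{ generalize (zshift (Z.of_nat s) (papply (p m) U)) (papply (p m) e)
          (papply (p m) y); intros.
        apply vec_ext; intros [|[]]; simpl; C_components; field; lra. }
    eapply sqsum_le_weaken.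
    { apply norm2_le_scale, norm2_le_add; eassumption. }
    rewrite Cnorm2_RtoC; apply Req_le; field; lra.
  - apply Rdiv_le_0_compat; [|lra].
    apply mult_half_pow_ge0, pow2_ge_0.
  - apply (coupling_decay U_coupled).
Qed.

Variable M : vec -> Prop.
Hypotheses (M_closed : closed_subspace k M) (M_Top : Top_invariant M) (M_h : M h).

Lemma coupled_basis_approx j n eps : (j < k)%nat -> 0 < eps -> exists q w,
  peval q C0 = RtoC 1 /\ M w /\ norm2_le k (vsub (papply q (basis (inr (j, n)))) w) eps.
Proof.
  intros Hj Heps.
  destruct (half_pow_eventually_le (2 + 4 * INR k * 2^n) eps Heps) as [N HN].
  set (m := (j + (N + n + 1) * k)%nat).
  assert (Hmod : (m mod k = j)%nat)
    by (unfold m; rewrite Nat.Div0.mod_add; now apply Nat.mod_small).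
  assert (Hm : (N + n + 1 <= m)%nat) by (unfold m; nia).
  exists (p m), (vscale (RtoC (/ a m)) (papply (p m) (Tpow (m * m - n)%nat h))).
  split; [apply (coupling_const U_coupled)|split].
  - apply (closed_subspace_scale M_closed), (invariant_papply M_closed M_Top).
    now apply invariant_Tpow.
  - rewrite <- Hmod; eapply sqsum_le_weaken; [apply norm2_le_papply_coupled; lia|].
    apply HN; lia.
Qed.

Lemma invariant_coupled_basis j n : (j < k)%nat -> M (basis (inr (j, n))).
Proof.
  intros Hj; induction n as [|n IH]; apply (invariant_of_Top M_closed M_Top);
    try (intros; now apply coupled_basis_approx).
  - replace (Top _) with vzero; [apply (closed_subspace_zero M_closed)|].
    apply vec_ext; intros [z|[i m]]; cbn -[idx_eq_dec];
      destruct idx_eq_dec as [Heq|]; congruence.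
  - replace (Top _) with (basis (inr (j, n))); [assumption|].
    apply vec_ext; intros [z|[i m]]; cbn -[idx_eq_dec];
      repeat destruct idx_eq_dec; congruence.
Qed.

Lemma invariant_bilateral_part : M U.
Proof.
  replace U with (vsub h (lacunary k a)) by (unfold h; vec_ring).
  apply (closed_subspace_sub M_closed); [assumption|].
  eapply (closed_subspace_basis_support M_closed); [apply norm2_le_lacunary|].
  intros [z|[j n]] Hne; [now destruct Hne|].
  destruct (Nat.lt_ge_cases j k) as [Hj|Hj]; [now apply invariant_coupled_basis|].
  destruct Hne; now apply coord_outside.
Qed.

End Coupling.

Lemma cyclic_of_annihilable k U B : (1 <= k)%nat ->
  norm2_le k U B -> bilateral U -> annihilable k U ->
  (forall M, closed_subspace k M -> (forall i, M (zshift i U)) ->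
     forall z, M (basis (inl z))) ->
  cyclic_T k.
Proof.
  intros Hk HB HU Hann Htotal.
  destruct (coupling_exists k U Hann) as (a & p & U_coupled).
  apply (cyclic_of_cyclic_subspace_total k (vadd U (lacunary k a))).
  - now apply (inH_coupled Hk HU U_coupled B).
  - intros x [_ [A HA]]; apply norm2_le_iff_energy in HA.
    set (h := vadd U (lacunary k a)).
    assert (M_closed := closed_subspace_cyclic k h).
    assert (M_Top := Top_invariant_cyclic k h).
    assert (M_h := cyclic_subspace_self k h).
    apply (closed_subspace_basis_support M_closed x A HA).
    intros [z|[j n]] Hne.
    + apply (Htotal _ M_closed); intros i.
      apply (invariant_zshift k _ U i M_closed M_Top HU Hann).
      now apply (invariant_bilateral_part Hk HU U_coupled).
    + destruct (Nat.lt_ge_cases j k) as [Hj|Hj].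
      * now apply (invariant_coupled_basis Hk HU U_coupled).
      * destruct Hne; now apply coord_outside.
Qed.

(** * Fourier coefficients *)

Definition Ccontinuous (F : R -> C) : Prop := forall t,
  continuous (fun t => fst (F t)) t /\ continuous (fun t => snd (F t)) t.

Lemma Ccontinuous_const c : Ccontinuous (fun _ => c).
Proof. intros t; split; apply continuous_const. Qed.

Lemma Ccontinuous_add F G :
  Ccontinuous F -> Ccontinuous G -> Ccontinuous (fun t => Cadd (F t) (G t)).
Proof.
  intros HF HG t; destruct (HF t), (HG t); split;
    [apply (continuous_plus (fun t => fst (F t)) (fun t => fst (G t)))
    |apply (continuous_plus (fun t => snd (F t)) (fun t => snd (G t)))]; assumption.
Qed.

Lemma Ccontinuous_mul F G :
  Ccontinuous F -> Ccontinuous G -> Ccontinuous (fun t => Cmul (F t) (G t)).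
Proof.
  assert (cont_mul : forall (f g : R -> R) t,
    continuous f t -> continuous g t -> continuous (fun t => f t * g t) t)
    by (intros f g; apply (continuous_mult f g)).
  intros HF HG t; destruct (HF t), (HG t); split;
    [apply (continuous_minus (fun t => fst (F t) * fst (G t)) (fun t => snd (F t) * snd (G t)))
    |apply (continuous_plus (fun t => fst (F t) * snd (G t)) (fun t => snd (F t) * fst (G t)))];
    auto.
Qed.

Lemma continuous_Cnorm2 F t : Ccontinuous F -> continuous (fun t => Cnorm2 (F t)) t.
Proof.
  intros HF; destruct (HF t).
  apply (continuous_plus (fun t => fst (F t) * fst (F t)) (fun t => snd (F t) * snd (F t)));
    [apply (continuous_mult (fun t => fst (F t)) (fun t => fst (F t)))
    |apply (continuous_mult (fun t => snd (F t)) (fun t => snd (F t)))]; assumption.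
Qed.

Definition mode (n : Z) (t : R) : C := (cos (IZR n * t), sin (IZR n * t)).

Lemma Ccontinuous_mode n : Ccontinuous (mode n).
Proof.
  intros t; split; unfold mode; simpl.
  - apply (ex_derive_continuous (fun t => cos (IZR n * t))); auto_derive; trivial.
  - apply (ex_derive_continuous (fun t => sin (IZR n * t))); auto_derive; trivial.
Qed.

Lemma mode_0 t : mode 0 t = RtoC 1.
Proof. unfold mode; now rewrite Rmult_0_l, cos_0, sin_0. Qed.

Lemma mode_add m n t : Cmul (mode m t) (mode n t) = mode (m + n) t.
Proof.
  unfold mode, Cmul; simpl; rewrite plus_IZR, Rmult_plus_distr_r, cos_plus, sin_plus.
  f_equal; ring.
Qed.

Lemma Cnorm2_mode n t : Cnorm2 (mode n t) = 1.
Proof. unfold Cnorm2; simpl; rewrite Rplus_comm; apply sin2_cos2. Qed.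

Lemma Ccontinuous_peval_mode p : Ccontinuous (fun t => peval p (mode 1 t)).
Proof.
  induction p; simpl;
    auto using Ccontinuous_const, Ccontinuous_add, Ccontinuous_mul, Ccontinuous_mode.
Qed.

Lemma continuous_ex_RInt (f : R -> R) a b : (forall t, continuous f t) -> ex_RInt f a b.
Proof. intros Hf; apply (ex_RInt_continuous f); auto. Qed.

Lemma continuous_linear (a b : R) (f g : R -> R) t :
  continuous f t -> continuous g t -> continuous (fun t => a * f t + b * g t) t.
Proof.
  intros Hf Hg; apply (continuous_plus (fun t => a * f t) (fun t => b * g t));
    [apply (continuous_mult (fun _ => a) f)|apply (continuous_mult (fun _ => b) g)];
    auto using continuous_const.
Qed.

Lemma RInt_linear (a b : R) (f g h : R -> R) u v :
  (forall t, continuous f t) -> (forall t, continuous g t) ->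
  (forall t, h t = a * f t + b * g t) -> RInt h u v = a * RInt f u v + b * RInt g u v.
Proof.
  intros Hf Hg Hh; apply is_RInt_unique, is_RInt_ext with (fun t => a * f t + b * g t);
    [now intros t _|].
  apply (is_RInt_plus (fun t => a * f t) (fun t => b * g t));
    [apply (is_RInt_scal f)|apply (is_RInt_scal g)];
    apply (RInt_correct (V := R_CompleteNormedModule)); now apply continuous_ex_RInt.
Qed.

Lemma RInt_const_R c a b : RInt (fun _ => c) a b = (b - a) * c :> R.
Proof. apply (RInt_const (V := R_CompleteNormedModule)). Qed.

Lemma RInt_const_le (f : R -> R) a b c : (forall t, continuous f t) -> a <= b ->
  (forall t, a < t < b -> f t <= c) -> RInt f a b <= (b - a) * c.
Proof.
  intros Hf Hab Hfc; rewrite <- RInt_const_R.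
  apply RInt_le; [assumption| | |assumption]; apply continuous_ex_RInt;
    [assumption|intros; apply continuous_const].
Qed.

Lemma RInt_derive_eq0 (f g : R -> R) a b : (forall t, is_derive f t (g t)) ->
  (forall t, continuous g t) -> f a = f b -> RInt g a b = 0.
Proof.
  intros Hf Hg Hfab; apply is_RInt_unique.
  replace 0 with (minus (f b) (f a)) by (rewrite Hfab; apply Rminus_diag).
  apply (is_RInt_derive f); auto.
Qed.

Definition Cint (F : R -> C) : C :=
  (RInt (fun t => fst (F t)) 0 (2 * PI), RInt (fun t => snd (F t)) 0 (2 * PI)).

Lemma Cint_ext F G : (forall t, F t = G t) -> Cint F = Cint G.
Proof. intros HFG; f_equal; now apply functional_extensionality. Qed.

Lemma Cint_add F G : Ccontinuous F -> Ccontinuous G ->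
  Cint (fun t => Cadd (F t) (G t)) = Cadd (Cint F) (Cint G).
Proof.
  intros HF HG; apply injective_projections; simpl.
  - rewrite (RInt_linear 1 1 (fun t => fst (F t)) (fun t => fst (G t)));
      [ring|apply HF|apply HG|intros; ring].
  - rewrite (RInt_linear 1 1 (fun t => snd (F t)) (fun t => snd (G t)));
      [ring|apply HF|apply HG|intros; ring].
Qed.

Lemma Cint_scale c F : Ccontinuous F -> Cint (fun t => Cmul c (F t)) = Cmul c (Cint F).
Proof.
  intros HF; apply injective_projections; simpl.
  - rewrite (RInt_linear (fst c) (- snd c) (fun t => fst (F t)) (fun t => snd (F t)));
      [ring|apply HF|apply HF|intros; ring].
  - rewrite (RInt_linear (fst c) (snd c) (fun t => snd (F t)) (fun t => fst (F t)));
      [ring|apply HF|apply HF|intros; ring].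
Qed.

Lemma cos_IZR_2PI n : cos (IZR n * (2 * PI)) = 1.
Proof.
  replace (IZR n * (2 * PI)) with (2 * (IZR n * PI)) by ring.
  rewrite cos_2a_sin, (sin_eq_0_1 (IZR n * PI)) by (now exists n); ring.
Qed.

Lemma sin_IZR_2PI n : sin (IZR n * (2 * PI)) = 0.
Proof. apply sin_eq_0_1; exists (n * 2)%Z; rewrite mult_IZR; ring. Qed.

Lemma Cint_mode n : Cint (mode n) = if Z.eq_dec n 0 then RtoC (2 * PI) else C0.
Proof.
  destruct (Z.eq_dec n 0) as [->|Hn].
  - rewrite (Cint_ext _ _ mode_0); C_components; rewrite RInt_const_R; ring.
  - apply not_0_IZR in Hn; C_components.
    + apply (RInt_derive_eq0 (fun t => sin (IZR n * t) / IZR n)).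
      * intros t; auto_derive; [trivial|now field].
      * intros t; apply (Ccontinuous_mode n t).
      * now rewrite sin_IZR_2PI, Rmult_0_r, sin_0.
    + apply (RInt_derive_eq0 (fun t => - cos (IZR n * t) / IZR n)).
      * intros t; auto_derive; [trivial|now field].
      * intros t; apply (Ccontinuous_mode n t).
      * now rewrite cos_IZR_2PI, Rmult_0_r, cos_0.
Qed.

Definition coef (F : R -> C) (n : Z) : C :=
  Cmul (RtoC (/ (2 * PI))) (Cint (fun t => Cmul (mode (- n) t) (F t))).

Lemma Cint_coef F n :
  Cint (fun t => Cmul (mode (- n) t) (F t)) = Cmul (RtoC (2 * PI)) (coef F n).
Proof.
  unfold coef; generalize (Cint (fun t => Cmul (mode (- n) t) (F t))) PI_RGT_0; intros.
  C_components; field; lra.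
Qed.

Lemma coef_add F G n : Ccontinuous F -> Ccontinuous G ->
  coef (fun t => Cadd (F t) (G t)) n = Cadd (coef F n) (coef G n).
Proof.
  intros HF HG; unfold coef.
  rewrite (Cint_ext _ (fun t => Cadd (Cmul (mode (- n) t) (F t)) (Cmul (mode (- n) t) (G t))))
    by (intros; C_ring).
  rewrite Cint_add by auto using Ccontinuous_mul, Ccontinuous_mode. C_ring.
Qed.

Lemma coef_scale c F n : Ccontinuous F ->
  coef (fun t => Cmul c (F t)) n = Cmul c (coef F n).
Proof.
  intros HF; unfold coef.
  rewrite (Cint_ext _ (fun t => Cmul c (Cmul (mode (- n) t) (F t)))) by (intros; C_ring).
  rewrite Cint_scale by auto using Ccontinuous_mul, Ccontinuous_mode. C_ring.
Qed.

Lemma coef_mode_mul m F n : coef (fun t => Cmul (mode m t) (F t)) n = coef F (n - m).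
Proof.
  unfold coef; f_equal; apply Cint_ext; intros t.
  replace (- (n - m))%Z with (- n + m)%Z by lia. rewrite <- mode_add; C_ring.
Qed.

Lemma coef_mode m n : coef (mode m) n = if Z.eq_dec n m then RtoC 1 else C0.
Proof.
  assert (HPI := PI_RGT_0); unfold coef.
  rewrite (Cint_ext _ _ (mode_add (- n) m)), Cint_mode.
  destruct (Z.eq_dec (- n + m) 0), (Z.eq_dec n m); try lia; C_components; field; lra.
Qed.

Lemma Cnorm2_sub_mode a c n t :
  Cnorm2 (Cadd a (Cmul (Copp c) (mode n t)))
  = Cnorm2 a + (-2 * fst (Cmul (fst c, - snd c) (Cmul (mode (- n) t) a)) + Cnorm2 c).
Proof.
  assert (Hmode := Cnorm2_mode n t); unfold mode in *.
  rewrite opp_IZR, Ropp_mult_distr_l_reverse, cos_neg, sin_neg.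
  unfold Cnorm2 in *; simpl in *; nra.
Qed.

Lemma RInt_Cnorm2_sub_mode F n : Ccontinuous F ->
  RInt (fun t => Cnorm2 (Cadd (F t) (Cmul (Copp (coef F n)) (mode n t)))) 0 (2 * PI)
  = RInt (fun t => Cnorm2 (F t)) 0 (2 * PI) - 2 * PI * Cnorm2 (coef F n) :> R.
Proof.
  intros HF; set (c := coef F n).
  set (W := fun t => Cmul (fst c, - snd c) (Cmul (mode (- n) t) (F t))).
  assert (HW : Ccontinuous W)
    by (unfold W; auto using Ccontinuous_mul, Ccontinuous_const, Ccontinuous_mode).
  assert (Hcross : RInt (fun t => fst (W t)) 0 (2 * PI) = 2 * PI * Cnorm2 c).
  { change (fst (Cint W) = 2 * PI * Cnorm2 c); unfold W.
    rewrite Cint_scale, Cint_coef by auto using Ccontinuous_mul, Ccontinuous_mode.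
    fold c; unfold Cnorm2; simpl; ring. }
  clearbody c; set (cross := fun t => -2 * fst (W t) + Cnorm2 c * 1).
  rewrite (RInt_linear 1 1 (fun t => Cnorm2 (F t)) cross),
    (RInt_linear (-2) (Cnorm2 c) (fun t => fst (W t)) (fun _ => 1) cross), Hcross.
  - rewrite RInt_const_R; ring.
  - intros t; apply (HW t).
  - intros; apply continuous_const.
  - reflexivity.
  - intros; now apply continuous_Cnorm2.
  - intros t; apply continuous_linear; [apply (HW t)|apply continuous_const].
  - intros t; rewrite Cnorm2_sub_mode; fold (W t); unfold cross; ring.
Qed.

(* [G] is [F] with the frequencies in [l] removed one at a time. *)
Lemma bessel_residual F l : Ccontinuous F -> NoDup l ->
  exists G, Ccontinuous G /\ (forall n, ~ In n l -> coef G n = coef F n) /\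
    RInt (fun t => Cnorm2 (G t)) 0 (2 * PI)
    = RInt (fun t => Cnorm2 (F t)) 0 (2 * PI)
      - 2 * PI * lsum (fun n => Cnorm2 (coef F n)) l :> R.
Proof.
  intros HF; induction 1 as [|n l Hn Hl (G & HG & Hcoef & Hint)].
  - exists F; split; [assumption|split; [reflexivity|]].
    cbn [lsum fold_right]; now rewrite Rmult_0_r, Rminus_0_r.
  - assert (Hmode : Ccontinuous (fun t => Cmul (Copp (coef G n)) (mode n t)))
      by auto using Ccontinuous_mul, Ccontinuous_const, Ccontinuous_mode.
    exists (fun t => Cadd (G t) (Cmul (Copp (coef G n)) (mode n t))); split; [|split].
    + now apply Ccontinuous_add.
    + intros m Hm; rewrite coef_add, coef_scale, coef_mode by auto using Ccontinuous_mode.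
      destruct (Z.eq_dec m n) as [->|]; [destruct Hm; now left|].
      rewrite Hcoef by (intros Hml; apply Hm; now right). C_ring.
    + rewrite RInt_Cnorm2_sub_mode, Hint, Hcoef by assumption.
      cbn [lsum fold_right]; fold (lsum (fun n => Cnorm2 (coef F n)) l); ring.
Qed.

Lemma bessel F l : Ccontinuous F -> NoDup l ->
  2 * PI * lsum (fun n => Cnorm2 (coef F n)) l <= RInt (fun t => Cnorm2 (F t)) 0 (2 * PI).
Proof.
  intros HF Hl; destruct (bessel_residual F l HF Hl) as (G & HG & _ & Hint).
  enough (0 <= RInt (fun t => Cnorm2 (G t)) 0 (2 * PI)) by lra.
  apply RInt_ge_0; [generalize PI_RGT_0; lra| |intros; apply Cnorm2_ge0].
  apply continuous_ex_RInt; intros; now apply continuous_Cnorm2.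
Qed.

Definition fourier (F : R -> C) : vec := (coef F, fun _ _ => C0).

Lemma fourier_add F G : Ccontinuous F -> Ccontinuous G ->
  fourier (fun t => Cadd (F t) (G t)) = vadd (fourier F) (fourier G).
Proof.
  intros HF HG; apply vec_ext; intros [n|[j n]]; simpl; [now apply coef_add|C_ring].
Qed.

Lemma fourier_scale c F : Ccontinuous F ->
  fourier (fun t => Cmul c (F t)) = vscale c (fourier F).
Proof.
  intros HF; apply vec_ext; intros [n|[j n]]; simpl; [now apply coef_scale|C_ring].
Qed.

Lemma fourier_mode_mul m F : fourier (fun t => Cmul (mode m t) (F t)) = zshift m (fourier F).
Proof. apply vec_ext; intros [n|[j n]]; [apply coef_mode_mul|reflexivity]. Qed.

Lemma fourier_mode m : fourier (mode m) = basis (inl m).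
Proof.
  apply vec_ext; intros [n|[j n]]; cbn -[idx_eq_dec Z.eq_dec];
    [rewrite coef_mode; destruct Z.eq_dec|]; destruct idx_eq_dec; congruence.
Qed.

Lemma norm2_le_fourier k F B : Ccontinuous F ->
  RInt (fun t => Cnorm2 (F t)) 0 (2 * PI) <= 2 * PI * B -> norm2_le k (fourier F) B.
Proof.
  intros HF HB; apply norm2_le_iff_energy; intros l m Hl _.
  rewrite energy_lsum, lsum_app, !lsum_map.
  rewrite (lsum_ext (fun p => Cnorm2 (coord k (fourier F) (inr p))) (fun _ => 0)), lsum_const.
  2:{ intros [j n]; simpl; destruct (j <? k)%nat; apply Cnorm2_C0. }
  generalize (bessel F l HF Hl) PI_RGT_0; simpl; intros.
  apply Rmult_le_reg_l with (2 * PI); lra.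
Qed.

Lemma norm2_le_fourier_sup k F B : Ccontinuous F ->
  (forall t, Cnorm2 (F t) <= B) -> norm2_le k (fourier F) B.
Proof.
  intros HF HB; apply norm2_le_fourier; [assumption|].
  rewrite <- (Rminus_0_r (2 * PI)) at 2; apply RInt_const_le.
  - intros; now apply continuous_Cnorm2.
  - generalize PI_RGT_0; lra.
  - auto.
Qed.

Lemma papply_fourier p F : Ccontinuous F ->
  papply p (fourier F) = fourier (fun t => Cmul (peval p (mode 1 t)) (F t)).
Proof.
  revert F; induction p as [c| |p IHp q IHq|p IHp q IHq]; intros F HF; cbn [papply peval].
  - now rewrite fourier_scale.
  - now rewrite fourier_mode_mul.
  - rewrite IHp, IHq, <- fourier_add by auto using Ccontinuous_mul, Ccontinuous_peval_mode.
    f_equal; apply functional_extensionality; intros; C_ring.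
  - rewrite IHq, IHp by auto using Ccontinuous_mul, Ccontinuous_peval_mode.
    f_equal; apply functional_extensionality; intros; C_ring.
Qed.

(** * A weight with non-integrable logarithm *)

Definition haversine (t : R) : R := (1 - cos t) / 2.

Lemma haversine_bounds t : 0 <= haversine t <= 1.
Proof. unfold haversine; generalize (COS_bound t); lra. Qed.

Lemma continuous_haversine t : continuous haversine t.
Proof. apply (ex_derive_continuous haversine); unfold haversine; auto_derive; trivial. Qed.

Definition flat (s : R) : R := if Rlt_dec 0 s then exp (- / s) else 0.

Lemma flat_pos s : 0 < s -> flat s = exp (- / s).
Proof. intros Hs; unfold flat; destruct (Rlt_dec 0 s); [reflexivity|lra]. Qed.

Lemma flat_npos s : s <= 0 -> flat s = 0.
Proof. intros Hs; unfold flat; destruct (Rlt_dec 0 s); [lra|reflexivity]. Qed.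

Lemma flat_ge0 s : 0 <= flat s.
Proof. unfold flat; destruct (Rlt_dec 0 s); [apply Rlt_le, exp_pos|lra]. Qed.

Lemma flat_le_Rabs s : flat s <= Rabs s.
Proof.
  destruct (Rlt_le_dec 0 s) as [Hs|Hs]; [|rewrite flat_npos by assumption; apply Rabs_pos].
  rewrite flat_pos, exp_Ropp, Rabs_pos_eq by lra. rewrite <- (Rinv_inv s) at 2.
  apply Rinv_le_contravar; [now apply Rinv_0_lt_compat|].
  generalize (exp_ineq1_le (/ s)); lra.
Qed.

Lemma continuous_flat s : continuous flat s.
Proof.
  destruct (Rtotal_order s 0) as [Hs|[->|Hs]].
  - apply continuous_ext_loc with (fun _ => 0); [|apply continuous_const].
    apply filter_imp with (fun y => y < 0); [|now apply (open_lt 0)].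
    intros y Hy; now rewrite flat_npos by lra.
  - apply continuity_pt_filterlim; intros eps Heps; exists eps; split; [assumption|].
    intros y [_ Hy]; simpl in *; unfold R_dist in *.
    rewrite (flat_npos 0), Rminus_0_r, Rabs_pos_eq in * by (apply flat_ge0 || lra).
    generalize (flat_le_Rabs y); lra.
  - apply continuous_ext_loc with (fun s => exp (- / s)).
    + apply filter_imp with (fun y => 0 < y); [|now apply (open_gt 0)].
      intros y Hy; now rewrite flat_pos.
    + apply (ex_derive_continuous (fun s => exp (- / s))); auto_derive; lra.
Qed.

Definition weight (t : R) : C := RtoC (flat (haversine t)).

Lemma Ccontinuous_weight : Ccontinuous weight.
Proof.
  intros t; split; simpl; [|apply continuous_const].
  apply (continuous_comp haversine flat); [apply continuous_haversine|apply continuous_flat].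
Qed.

Lemma Cnorm2_weight_le1 t : Cnorm2 (weight t) <= 1.
Proof.
  assert (Hh := haversine_bounds t); assert (Hle := flat_le_Rabs (haversine t)).
  rewrite Rabs_pos_eq in Hle by lra.
  unfold weight; rewrite Cnorm2_RtoC; generalize (flat_ge0 (haversine t)); nra.
Qed.

Fixpoint ppow (p : poly) (N : nat) : poly :=
  match N with O => PConst (RtoC 1) | S N => PMul p (ppow p N) end.

Lemma peval_ppow_C1 p N z : peval p z = RtoC 1 -> peval (ppow p N) z = RtoC 1.
Proof. intros Hp; induction N as [|N IH]; simpl; [|rewrite Hp, IH; C_ring]; reflexivity. Qed.

Lemma Cnorm2_peval_ppow p N z : Cnorm2 (peval (ppow p N) z) = Cnorm2 (peval p z) ^ N.
Proof.
  induction N as [|N IH]; simpl; [unfold Cnorm2; simpl; ring|].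
  now rewrite Cnorm2_mul, IH.
Qed.

Lemma peval_ppow_PX_mode N t : peval (ppow PX N) (mode 1 t) = mode (Z.of_nat N) t.
Proof.
  induction N as [|N IH]; cbn [ppow peval]; [symmetry; apply mode_0|].
  rewrite IH, mode_add; f_equal; lia.
Qed.

Fixpoint dirichlet (n : nat) : poly :=
  match n with
  | O => PConst (RtoC 1)
  | S n' => PAdd (dirichlet n') (PMul (PConst (RtoC 2)) (ppow PX n))
  end.

(* On the unit circle the real part is [n] times the Fejer kernel. *)
Fixpoint fejer (n : nat) : poly :=
  match n with
  | O => PConst C0
  | S n => PAdd (fejer n) (dirichlet n)
  end.

Lemma peval_dirichlet_C0 n : peval (dirichlet n) C0 = RtoC 1.
Proof.
  induction n as [|n IH]; [reflexivity|]. cbn [dirichlet peval ppow]; rewrite IH; C_ring.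
Qed.

Lemma peval_fejer_C0 n : peval (fejer n) C0 = RtoC (INR n).
Proof.
  induction n as [|n IH]; [reflexivity|]. cbn [fejer peval].
  rewrite IH, peval_dirichlet_C0, S_INR; C_ring.
Qed.

Lemma Re_dirichlet n t : fst (peval (dirichlet n) (mode 1 t)) * (1 - cos t)
  = cos (IZR (Z.of_nat n) * t) - cos (IZR (Z.of_nat (S n)) * t).
Proof.
  induction n as [|n IH].
  - simpl; rewrite Rmult_0_l, cos_0, !Rmult_1_l; ring.
  - cbn [dirichlet]; set (q := ppow PX (S n)).
    assert (Hq : peval q (mode 1 t) = mode (Z.of_nat (S n)) t) by apply peval_ppow_PX_mode.
    cbn [peval]; rewrite Hq; unfold Cadd, Cmul, RtoC, mode at 2 3; cbn [fst snd].
    rewrite Rmult_plus_distr_r, IH, !Nat2Z.inj_succ, !succ_IZR.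
    set (y := (IZR (Z.of_nat n) + 1) * t).
    replace (IZR (Z.of_nat n) * t) with (y - t) by (unfold y; ring).
    replace ((IZR (Z.of_nat n) + 1 + 1) * t) with (y + t) by (unfold y; ring).
    rewrite cos_minus, cos_plus; ring.
Qed.

Lemma Re_fejer n t :
  fst (peval (fejer n) (mode 1 t)) * (1 - cos t) = 1 - cos (IZR (Z.of_nat n) * t).
Proof.
  induction n as [|n IH].
  - simpl; rewrite !Rmult_0_l, cos_0; ring.
  - cbn [fejer peval]; unfold Cadd; cbn [fst].
    rewrite Rmult_plus_distr_r, IH, Re_dirichlet; ring.
Qed.

Lemma Re_fejer_le n t :
  0 < haversine t -> fst (peval (fejer n) (mode 1 t)) <= / haversine t.
Proof.
  intros Ht; apply Rmult_le_reg_r with (haversine t); [assumption|].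
  rewrite Rinv_l by lra; unfold haversine.
  generalize (Re_fejer n t) (COS_bound (IZR (Z.of_nat n) * t)); lra.
Qed.

Lemma exp_pow x n : exp x ^ n = exp (INR n * x).
Proof. rewrite <- Rpower_pow by apply exp_pos; unfold Rpower; now rewrite ln_exp. Qed.

Lemma exp_le_compat x y : x <= y -> exp x <= exp y.
Proof. intros [Hlt| ->]; [apply Rlt_le, exp_increasing, Hlt|lra]. Qed.

Lemma Cnorm2_compound_le_exp w N : (0 < N)%nat ->
  Cnorm2 (Cadd (RtoC 1) (Cmul (RtoC (/ INR N)) w)) ^ N
  <= exp (2 * fst w + Cnorm2 w / INR N).
Proof.
  intros HN; apply lt_0_INR in HN.
  replace (2 * fst w + Cnorm2 w / INR N)
    with (INR N * (2 * fst w / INR N + Cnorm2 w / (INR N * INR N))) by (field; lra).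
  rewrite <- exp_pow; apply pow_incr; split; [apply Cnorm2_ge0|].
  eapply Rle_trans; [|apply exp_ineq1_le].
  apply Req_le; unfold Cnorm2; simpl; field; lra.
Qed.

Definition centered_fejer (n : nat) : poly := PAdd (fejer n) (PConst (RtoC (- INR n))).

Definition fejer_annihilator (n N : nat) : poly :=
  ppow (PAdd (PConst (RtoC 1)) (PMul (PConst (RtoC (/ INR N))) (centered_fejer n))) N.

Lemma peval_fejer_annihilator_C0 n N : peval (fejer_annihilator n N) C0 = RtoC 1.
Proof. apply peval_ppow_C1; simpl; rewrite peval_fejer_C0; C_ring. Qed.

Lemma Cnorm2_fejer_annihilator_weight_le n N t :
  (0 < N)%nat -> pbound (centered_fejer n) <= INR N ->
  Cnorm2 (Cmul (peval (fejer_annihilator n N) (mode 1 t)) (weight t))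
  <= exp (1 - 2 * INR n).
Proof.
  intros HN Hbound; set (w := peval (centered_fejer n) (mode 1 t)).
  unfold fejer_annihilator, weight.
  rewrite Cnorm2_mul, Cnorm2_peval_ppow, Cnorm2_RtoC; cbn [peval]; fold w.
  destruct (Rlt_le_dec 0 (haversine t)) as [Ht|Ht].
  - assert (Hre : fst w <= / haversine t - INR n).
    { assert (Hfejer := Re_fejer_le n t Ht).
      unfold w, centered_fejer, RtoC; cbn [peval]; unfold Cadd; cbn [fst]; lra. }
    assert (Hw : Cnorm2 w / INR N <= 1).
    { apply Rle_div_l; [now apply lt_0_INR|].
      generalize (Cnorm2_peval_le (centered_fejer n) (mode 1 t)); fold w.
      rewrite Cnorm2_mode; lra. }
    rewrite flat_pos, exp_pow by assumption.
    eapply Rle_trans.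
    { apply Rmult_le_compat_r; [apply Rlt_le, exp_pos|now apply Cnorm2_compound_le_exp]. }
    rewrite <- exp_plus; apply exp_le_compat; cbn [INR]; lra.
  - rewrite flat_npos, pow_i, Rmult_0_r by (assumption || lia); apply Rlt_le, exp_pos.
Qed.

Lemma annihilable_weight k : annihilable k (fourier weight).
Proof.
  intros eps Heps.
  destruct (INR_unbounded (/ eps)) as [n Hn].
  destruct (INR_unbounded (pbound (centered_fejer n))) as [N HN].
  assert (HN0 : (0 < N)%nat)
    by (apply INR_lt; simpl; generalize (pbound_ge1 (centered_fejer n)); lra).
  exists (fejer_annihilator n N); split; [apply peval_fejer_annihilator_C0|].
  rewrite papply_fourier by apply Ccontinuous_weight.
  apply norm2_le_fourier_sup.
  - apply Ccontinuous_mul; [apply Ccontinuous_peval_mode|apply Ccontinuous_weight].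
  - intros t; eapply Rle_trans; [apply Cnorm2_fejer_annihilator_weight_le; [assumption|lra]|].
    assert (Hinv : 0 < / eps) by now apply Rinv_0_lt_compat.
    replace (1 - 2 * INR n) with (- (2 * INR n - 1)) by ring.
    rewrite exp_Ropp, <- (Rinv_inv eps).
    apply Rinv_le_contravar; [assumption|].
    generalize (exp_ineq1_le (2 * INR n - 1)); lra.
Qed.

(** * Approximate inversion of the weight *)

Definition geometric_inv (J : nat) (s : R) : R := sum_f_R0 (pow (1 - s)) J.

Lemma geometric_inv_mul J s : s * geometric_inv J s = 1 - (1 - s) ^ S J.
Proof.
  assert (Hsum : geometric_inv J s * (1 - s - 1) = (1 - s) ^ (J + 1) - 1)
    by apply GP_finite.
  rewrite Nat.add_1_r in Hsum; lra.
Qed.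

Lemma pow_le_one x n : 0 <= x <= 1 -> x ^ n <= 1.
Proof. intros Hx; apply Rle_trans with (1 ^ n); [now apply pow_incr|rewrite pow1; lra]. Qed.

Lemma geometric_inv_bounds J s : 0 <= s <= 1 -> 0 <= geometric_inv J s <= INR (S J).
Proof.
  intros Hs; unfold geometric_inv; split.
  - apply cond_pos_sum; intros; apply pow_le; lra.
  - rewrite <- (Rmult_1_l (INR (S J))), <- sum_cte; apply sum_Rle; intros n _.
    apply pow_le_one; lra.
Qed.

Lemma geometric_inv_le J s : 0 < s <= 1 -> geometric_inv J s <= / s.
Proof.
  intros Hs; apply Rmult_le_reg_l with s; [lra|].
  rewrite geometric_inv_mul, Rinv_r by lra.
  generalize (pow_le (1 - s) (S J)); lra.
Qed.

Lemma pow_one_minus_le n s : 0 <= s <= 1 -> (1 - s) ^ n * (1 + INR n * s) <= 1.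
Proof.
  intros Hs; apply Rle_trans with (((1 - s) * (1 + s)) ^ n).
  - rewrite Rpow_mult_distr; apply Rmult_le_compat_l; [apply pow_le; lra|].
    apply Rle_pow_lin; lra.
  - apply pow_le_one; nra.
Qed.

Lemma inv_sub_geometric_inv_le J c s : 0 < c -> c <= s <= 1 ->
  / s - geometric_inv J s <= / (c * c) / INR (S J).
Proof.
  intros Hc Hs; set (n := S J).
  assert (Hn : 0 < INR n) by (apply lt_0_INR; unfold n; lia).
  assert (Hpow : 0 <= (1 - s) ^ n) by (apply pow_le; lra).
  assert (Hlin : (1 - s) ^ n * (INR n * s) <= 1) by (generalize (pow_one_minus_le n s); nra).
  apply Rle_trans with (/ (s * s) / INR n).
  - replace (/ s - geometric_inv J s) with ((1 - s) ^ n / s).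
    2:{ replace ((1 - s) ^ n) with (1 - s * geometric_inv J s)
          by (rewrite geometric_inv_mul; fold n; ring). field; lra. }
    apply Rmult_le_reg_r with (s * s * INR n); [apply Rmult_lt_0_compat; nra|].
    replace ((1 - s) ^ n / s * (s * s * INR n)) with ((1 - s) ^ n * (INR n * s))
      by (field; lra).
    replace (/ (s * s) / INR n * (s * s * INR n)) with 1 by (field; lra). assumption.
  - apply Rmult_le_compat_r; [apply Rlt_le; now apply Rinv_0_lt_compat|].
    apply Rinv_le_contravar; nra.
Qed.

Lemma compound_le_exp y n : 0 <= y -> (1 + y) ^ n <= exp (INR n * y).
Proof. intros Hy; rewrite <- exp_pow; apply pow_incr; split; [lra|apply exp_ineq1_le]. Qed.

Lemma exp_le_compound y n : 0 <= y -> exp (INR n * (y - y * y)) <= (1 + y) ^ n.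
Proof.
  intros Hy; rewrite <- exp_pow; apply pow_incr; split; [apply Rlt_le, exp_pos|].
  assert (Hexp := exp_pos (y - y * y)).
  assert (Hinv := exp_ineq1_le (- (y - y * y))); rewrite exp_Ropp in Hinv.
  apply Rmult_le_reg_r with (/ exp (y - y * y)); [now apply Rinv_0_lt_compat|].
  rewrite Rinv_r by lra; nra.
Qed.

(* A polynomial in [s] imitating [exp (1/s)]: the exponent of the compound power
   is so large that its error is negligible against that of the geometric sum. *)
Definition exp_inv_approx (J : nat) (s : R) : R :=
  let N := (S J * S J * S J)%nat in (1 + / INR N * geometric_inv J s) ^ N.

Lemma exp_inv_approx_bounds J s : 0 <= s <= 1 ->
  let r := geometric_inv J s in
  exp (r - / INR (S J)) <= exp_inv_approx J s <= exp r.
Proof.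
  intros Hs r; set (n := INR (S J)).
  assert (Hr : 0 <= r <= n) by now apply geometric_inv_bounds.
  assert (Hn : 0 < n) by (apply lt_0_INR; lia).
  unfold exp_inv_approx; set (N := (S J * S J * S J)%nat); fold r.
  assert (HN : INR N = n * n * n) by (unfold N; now rewrite !mult_INR).
  assert (HNpos : 0 < n * n * n) by (repeat apply Rmult_lt_0_compat; assumption).
  assert (Hy : 0 <= / INR N * r)
    by (rewrite HN; apply Rmult_le_pos; [apply Rlt_le; now apply Rinv_0_lt_compat|lra]).
  split.
  - eapply Rle_trans; [|now apply exp_le_compound]. apply exp_le_compat; rewrite HN.
    replace (n * n * n * (/ (n * n * n) * r - / (n * n * n) * r * (/ (n * n * n) * r)))
      with (r - r * r / (n * n * n)) by (field; lra).
    assert (r * r / (n * n * n) <= / n); [|lra].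
    apply Rle_div_l; [assumption|]. replace (/ n * (n * n * n)) with (n * n) by (field; lra).
    nra.
  - eapply Rle_trans; [now apply compound_le_exp|].
    apply exp_le_compat; rewrite HN; apply Req_le; field; lra.
Qed.

Lemma exp_inv_approx_flat_bounds J s : 0 <= s <= 1 ->
  0 <= exp_inv_approx J s * flat s <= 1.
Proof.
  intros Hs; destruct (exp_inv_approx_bounds J s Hs) as [Hlo Hhi].
  split; [apply Rmult_le_pos; [generalize (exp_pos (geometric_inv J s - / INR (S J))); lra
                              |apply flat_ge0]|].
  destruct (Rlt_le_dec 0 s) as [Hpos|Hneg]; [|rewrite flat_npos by assumption; lra].
  rewrite flat_pos by assumption.
  eapply Rle_trans; [apply Rmult_le_compat_r; [apply Rlt_le, exp_pos|exact Hhi]|].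
  rewrite <- exp_plus, <- exp_0; apply exp_le_compat.
  generalize (geometric_inv_le J s); lra.
Qed.

Lemma one_minus_exp_inv_approx_flat_le J c s : 0 < c -> c <= s <= 1 ->
  1 - exp_inv_approx J s * flat s <= (/ (c * c) + 1) / INR (S J).
Proof.
  intros Hc Hs; destruct (exp_inv_approx_bounds J s) as [Hlo _]; [lra|].
  rewrite flat_pos by lra.
  apply (Rmult_le_compat_r (exp (- / s))) in Hlo; [|apply Rlt_le, exp_pos].
  rewrite <- exp_plus in Hlo.
  assert (Hexp := exp_ineq1_le (geometric_inv J s - / INR (S J) + - / s)).
  assert (Hgeo := inv_sub_geometric_inv_le J c s Hc Hs).
  unfold Rdiv in *; lra.
Qed.

Lemma RInt_circle_le (f : R -> R) d eta : (forall t, continuous f t) ->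
  0 <= d <= PI -> 0 <= eta -> (forall t, f t <= 1) ->
  (forall t, d < t < 2 * PI - d -> f t <= eta) ->
  RInt f 0 (2 * PI) <= 2 * d + 2 * PI * eta.
Proof.
  intros Hf Hd Heta Hf1 Hfeta.
  assert (Hint : forall a b, ex_RInt f a b) by (intros; now apply continuous_ex_RInt).
  rewrite <- (RInt_Chasles f 0 d), <- (RInt_Chasles f d (2 * PI - d)) by apply Hint.
  assert (RInt f 0 d <= (d - 0) * 1) by (apply RInt_const_le; auto; lra).
  assert (RInt f d (2 * PI - d) <= (2 * PI - d - d) * eta) by (apply RInt_const_le; auto; lra).
  assert (RInt f (2 * PI - d) (2 * PI) <= (2 * PI - (2 * PI - d)) * 1)
    by (apply RInt_const_le; auto; lra).
  unfold plus; simpl; nra.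
Qed.

Lemma haversine_ge d t : 0 <= d -> d <= t <= 2 * PI - d -> haversine d <= haversine t.
Proof.
  intros Hd Ht; unfold haversine. enough (cos t <= cos d) by lra.
  destruct (Rle_lt_dec t PI) as [Hle|Hlt]; [apply cos_decr_1; lra|].
  replace (cos t) with (cos (2 * PI - t))
    by (rewrite cos_minus, cos_2PI, sin_2PI; ring).
  apply cos_decr_1; lra.
Qed.

Lemma haversine_pos d : 0 < d <= PI -> 0 < haversine d.
Proof.
  intros Hd; unfold haversine; assert (cos d < cos 0) by (apply cos_decreasing_1; lra).
  rewrite cos_0 in *; lra.
Qed.

Lemma exp_inv_approx_flat_uniform d eps : 0 < d <= PI -> 0 < eps ->
  exists J, forall t, d < t < 2 * PI - d ->
    1 - exp_inv_approx J (haversine t) * flat (haversine t) <= eps.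
Proof.
  intros Hd Heps; set (c := haversine d).
  assert (Hc : 0 < c) by now apply haversine_pos.
  destruct (INR_archimed eps (/ (c * c) + 1) Heps) as [J HJ].
  exists J; intros t Ht.
  eapply Rle_trans; [apply one_minus_exp_inv_approx_flat_le with (c := c)|].
  - assumption.
  - split; [apply haversine_ge; lra|apply haversine_bounds].
  - apply Rle_div_l; [apply lt_0_INR; lia|]. rewrite S_INR; nra.
Qed.

Section ShiftInvariant.

Context {k : nat} {M : vec -> Prop} (M_closed : closed_subspace k M).

Definition shifts_in (F : R -> C) : Prop :=
  Ccontinuous F /\ forall i, M (zshift i (fourier F)).

Lemma shifts_in_ext F G : (forall t, F t = G t) -> shifts_in F -> shifts_in G.
Proof. intros HFG; now rewrite (functional_extensionality F G HFG). Qed.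

Lemma shifts_in_add F G :
  shifts_in F -> shifts_in G -> shifts_in (fun t => Cadd (F t) (G t)).
Proof.
  intros [F_cont HF] [G_cont HG]; split; [now apply Ccontinuous_add|intros i].
  rewrite fourier_add by assumption.
  replace (zshift i _) with (vadd (zshift i (fourier F)) (zshift i (fourier G))) by vec_ring.
  apply (closed_subspace_add M_closed); auto.
Qed.

Lemma shifts_in_scale c F : shifts_in F -> shifts_in (fun t => Cmul c (F t)).
Proof.
  intros [F_cont HF]; split;
    [auto using Ccontinuous_mul, Ccontinuous_const|intros i].
  rewrite fourier_scale by assumption.
  replace (zshift i _) with (vscale c (zshift i (fourier F))) by vec_ring.
  apply (closed_subspace_scale M_closed); auto.
Qed.

Lemma shifts_in_mode_mul n F : shifts_in F -> shifts_in (fun t => Cmul (mode n t) (F t)).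
Proof.
  intros [F_cont HF]; split; [auto using Ccontinuous_mul, Ccontinuous_mode|intros i].
  rewrite fourier_mode_mul.
  replace (zshift i _) with (zshift (i + n) (fourier F)); [apply HF|].
  apply vec_ext; intros [z|[j m]]; cbn [entry zshift fst snd]; [f_equal; lia|reflexivity].
Qed.

Lemma shifts_in_limit F : Ccontinuous F ->
  (forall eps, 0 < eps -> exists G, shifts_in G /\
     RInt (fun t => Cnorm2 (Cadd (F t) (Cmul (RtoC (-1)) (G t)))) 0 (2 * PI)
     <= 2 * PI * eps) ->
  shifts_in F.
Proof.
  intros F_cont Happrox; split; [assumption|intros i].
  apply (closed_subspace_limit M_closed); intros eps Heps.
  destruct (Happrox eps Heps) as (G & [G_cont HG] & Hclose).
  exists (zshift i (fourier G)); split; [apply HG|].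
  assert (NG_cont : Ccontinuous (fun t => Cmul (RtoC (-1)) (G t)))
    by auto using Ccontinuous_mul, Ccontinuous_const.
  replace (vsub _ _)
    with (zshift i (fourier (fun t => Cadd (F t) (Cmul (RtoC (-1)) (G t))))).
  - apply norm2_le_zshift, norm2_le_fourier; [now apply Ccontinuous_add|assumption].
  - rewrite fourier_add, fourier_scale by assumption; vec_ring.
Qed.

Definition multiplier (m : R -> R) : Prop :=
  forall F, shifts_in F -> shifts_in (fun t => Cmul (RtoC (m t)) (F t)).

Lemma multiplier_const r : multiplier (fun _ => r).
Proof. intros F; apply shifts_in_scale. Qed.

Lemma multiplier_add m n :
  multiplier m -> multiplier n -> multiplier (fun t => m t + n t).
Proof.
  intros Hm Hn F HF.
  apply shifts_in_ext
    with (fun t => Cadd (Cmul (RtoC (m t)) (F t)) (Cmul (RtoC (n t)) (F t)));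
    [intros; C_ring|apply shifts_in_add; auto].
Qed.

Lemma multiplier_mul m n :
  multiplier m -> multiplier n -> multiplier (fun t => m t * n t).
Proof.
  intros Hm Hn F HF.
  apply shifts_in_ext with (fun t => Cmul (RtoC (m t)) (Cmul (RtoC (n t)) (F t)));
    [intros; C_ring|auto].
Qed.

Lemma multiplier_pow m n : multiplier m -> multiplier (fun t => m t ^ n).
Proof.
  intros Hm; induction n as [|n IH]; simpl; [apply multiplier_const|].
  now apply multiplier_mul.
Qed.

Lemma multiplier_haversine : multiplier haversine.
Proof.
  intros F HF; apply shifts_in_ext with (fun t => Cadd (Cmul (RtoC (/ 2)) (F t))
    (Cmul (RtoC (- / 4)) (Cadd (Cmul (mode 1 t) (F t)) (Cmul (mode (-1) t) (F t))))).
  - intros t; unfold mode, haversine.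
    replace (-1 * t) with (- (1 * t)) by ring; rewrite cos_neg, sin_neg, Rmult_1_l.
    C_components; field.
  - auto using shifts_in_add, shifts_in_scale, shifts_in_mode_mul.
Qed.

Lemma multiplier_one_minus_haversine : multiplier (fun t => 1 - haversine t).
Proof.
  apply (multiplier_add (fun _ => 1)); [apply multiplier_const|].
  replace (fun t => - haversine t) with (fun t => -1 * haversine t)
    by (apply functional_extensionality; intros; ring).
  apply (multiplier_mul (fun _ => -1)); [apply multiplier_const|apply multiplier_haversine].
Qed.

Lemma multiplier_geometric_inv J : multiplier (fun t => geometric_inv J (haversine t)).
Proof.
  assert (Hpow : forall n, multiplier (fun t => (1 - haversine t) ^ n))
    by (intros; apply (multiplier_pow (fun t => 1 - haversine t));
        apply multiplier_one_minus_haversine).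
  unfold geometric_inv; induction J as [|J IH]; [apply (Hpow 0%nat)|].
  apply (multiplier_add (fun t => sum_f_R0 (pow (1 - haversine t)) J)); auto.
Qed.

Lemma multiplier_exp_inv_approx J : multiplier (fun t => exp_inv_approx J (haversine t)).
Proof.
  unfold exp_inv_approx; generalize (S J * S J * S J)%nat; intros N.
  apply (multiplier_pow (fun t => 1 + / INR N * geometric_inv J (haversine t))).
  apply (multiplier_add (fun _ => 1)); [apply multiplier_const|].
  apply (multiplier_mul (fun _ => / INR N)); [apply multiplier_const|].
  apply multiplier_geometric_inv.
Qed.

Lemma shifts_in_one : shifts_in weight -> shifts_in (fun _ => RtoC 1).
Proof.
  intros Hweight; apply shifts_in_limit; [apply Ccontinuous_const|intros eps Heps].
  assert (HPI : 2 < PI) by (generalize PI2_1; lra).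
  set (d := Rmin 1 (eps / 2)).
  assert (Hd : 0 < d <= 1 /\ d <= eps / 2).
  { unfold d; repeat split; [apply Rmin_glb_lt; lra|apply Rmin_l|apply Rmin_r]. }
  destruct (exp_inv_approx_flat_uniform d (eps / 2)) as [J HJ]; [lra|lra|].
  set (G := fun t => Cmul (RtoC (exp_inv_approx J (haversine t))) (weight t)).
  assert (HG : shifts_in G) by now apply multiplier_exp_inv_approx.
  exists G; split; [assumption|].
  assert (Herror : forall t, Cnorm2 (Cadd (RtoC 1) (Cmul (RtoC (-1)) (G t)))
    = (1 - exp_inv_approx J (haversine t) * flat (haversine t)) ^ 2)
    by (intros; unfold Cnorm2, G, weight; simpl; ring).
  assert (Hrange : forall t, 0 <= exp_inv_approx J (haversine t) * flat (haversine t) <= 1)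
    by (intros; apply exp_inv_approx_flat_bounds, haversine_bounds).
  eapply Rle_trans; [apply (RInt_circle_le _ d (eps / 2))|nra].
  - intros t; apply continuous_Cnorm2, Ccontinuous_add; [apply Ccontinuous_const|].
    apply Ccontinuous_mul; [apply Ccontinuous_const|apply HG].
  - lra.
  - lra.
  - intros t; rewrite Herror; specialize (Hrange t); nra.
  - intros t Ht; rewrite Herror; specialize (Hrange t); specialize (HJ t Ht); nra.
Qed.

End ShiftInvariant.

Lemma closed_subspace_zshift_weight k M : closed_subspace k M ->
  (forall i, M (zshift i (fourier weight))) -> forall z, M (basis (inl z)).
Proof.
  intros M_closed Hweight z.
  destruct (shifts_in_one M_closed) as [_ Hone].
  { split; [apply Ccontinuous_weight|assumption]. }
  specialize (Hone z); rewrite <- fourier_mode_mul in Hone; rewrite <- fourier_mode.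
  replace (mode z) with (fun t => Cmul (mode z t) (RtoC 1)); [assumption|].
  apply functional_extensionality; intros; C_ring.
Qed.

Theorem mainTheorem19 : forall k : nat, (1 <= k)%nat -> cyclic_T k.
Proof.
  intros k Hk; apply (cyclic_of_annihilable k (fourier weight) 1 Hk).
  - apply norm2_le_fourier_sup; [apply Ccontinuous_weight|apply Cnorm2_weight_le1].
  - intros j n; reflexivity.
  - apply annihilable_weight.
  - apply closed_subspace_zshift_weight.
Qed.
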